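(* Let $\lambda_1,\lambda_2$ be integers with $1\le\lambda_2\le\lambda_1$. The average case complexity of the Novelli--Pak--Stoyanovskii algorithm on the partition $\lambda=(\lambda_1,\lambda_2)$ satisfies $$\begin{aligned} C(\lambda_1,\lambda_2)={}&\frac{\lambda_1(\lambda_1-1)}{4}+\frac{\lambda_2(\lambda_2-3)}{4} -2\Bigg(-\frac{2^{\lambda_2}}{\binom{\lambda_1+\lambda_2}{\lambda_2}}\Big(\sum_{i=1}^{\lambda_2}\frac{\binom{i+\lambda_1}{i}}{2^i}+1\Big)\\ &+\frac{-1-\lambda_1+\lambda_2}{2}\sum_{i=1}^{\lambda_2}\frac{2^i}{i\binom{i+\lambda_1}{i}}\sum_{j=1}^{i}\frac{\binom{j+\lambda_1}{j}}{2^j} -\frac{1+\lambda_1-\lambda_2}{2}\sum_{i=1}^{\lambda_2}\frac{2^i}{i\binom{i+\lambda_1}{i}}\\ &+(1+\lambda_1-\lambda_2)\Big(H_{\lambda_1}+\tfrac12H_{\lambda_2}-H_{\lambda_1-\lambda_2}\Big)+1\Bigg). \end{aligned}$$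
   Context: $H_m=\sum_{\ell=1}^m\frac1\ell$ denotes the $m$-th harmonic number ($H_0=0$). A partition $\lambda$ of $n$ is identified with its Young diagram $\{(i,j):1\le i\le l(\lambda),\ 1\le j\le\lambda_i\}$ ($l(\lambda)$ is the number of parts), whose elements are called cells. A cell $(i,j)$ is a corner of $\lambda$ if neither $(i+1,j)$ nor $(i,j+1)$ belongs to $\lambda$. A tableau of shape $\lambda$ is a bijection $T:\lambda\to\{1,\dots,n\}$; the set of tableaux is $\mathrm{T}(\lambda)$. The (column-wise) Novelli--Pak--Stoyanovskii (NPS) algorithm applied to $T\in \mathrm{T}(\lambda)$: order cells by $(i,j)\preceq(i',j')$ if $j<j'$, or $j=j'$ and $i\le i'$. Let $(i_1,j_1)\succ\dots\succ(i_n,j_n)$ be the cells of $\lambda$ in decreasing order, put $k_r=T(i_r,j_r)$ (entries of the initial tableau) and $T_0=T$. For $r=1,\dots,n$ the tableau $T_r$ is obtained from $T_{r-1}$ as follows. Start with the current tableau equal to $T_{r-1}$ and repeat: let $(i,j)$ be the cell of the current tableau containing $k_r$. If $(i,j)$ is a corner of $\lambda$, stop. Otherwise let $m$ be the minimum of the entries of the current tableau in the cells of $\lambda\cap\{(i+1,j),(i,j+1)\}$. If $k_r<m$, stop. If $m<k_r$, exchange the entries $m$ and $k_r$ (one exchange) and repeat. When stopped, $T_r$ is the current tableau. $n(T)$ is the total number of exchanges performed during the construction of $T_1,\dots,T_n$, and $C(\lambda)=\frac1{n!}\sum_{T\in \mathrm{T}(\lambda)}n(T)$; $C(\lambda_1,\lambda_2)$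 means $C(\lambda)$ for $\lambda=(\lambda_1,\lambda_2)$. *)

(* Defs.v *)
From mathcomp Require Import all_boot all_order all_algebra.

Set Implicit Arguments.
Unset Strict Implicit.
Unset Printing Implicit Defensive.

Import GRing.Theory.

(* A partition is the sequence of its parts, la = [:: la_1; la_2; ...], with
   la_i = nth 0 la i.-1.  Cells are the pairs (i, j), both indices from 1. *)
Definition diagram (la : seq nat) : seq (nat * nat) :=
  [seq (i, j) | i <- iota 1 (size la), j <- iota 1 (nth 0 la i.-1)].

Definition cell (la : seq nat) : finType := seq_sub (diagram la).

Definition row_of (la : seq nat) (c : cell la) : nat := (ssval c).1.
Definition col_of (la : seq nat) (c : cell la) : nat := (ssval c).2.

(* The entries of a filling live in {0, ..., n}, where n = sumn la. *)
Definition filling (la : seq nat) : finType :=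
  {ffun cell la -> 'I_(sumn la).+1}.

(* T is a bijection from the diagram onto {1, ..., n}. *)
Definition is_tableau (la : seq nat) (T : filling la) : bool :=
  injectiveb T && (T @: [set: cell la] == [set k : 'I_(sumn la).+1 | 0 < k]).

Definition cell_le (la : seq nat) (c d : cell la) : bool :=
  (col_of c < col_of d) || (col_of c == col_of d) && (row_of c <= row_of d).

Definition decreasing_cells (la : seq nat) : seq (cell la) :=
  sort (fun c d => cell_le d c) (enum (cell la)).

(* d is one of (i+1, j) and (i, j+1), for c = (i, j); both cells are required
   to lie in the diagram by typing, so c is a corner iff it has no such d. *)
Definition below_or_right (la : seq nat) (c d : cell la) : bool :=
  (ssval d == ((row_of c).+1, col_of c))
  || (ssval d == (row_of c, (col_of c).+1)).

(* The pair (c, d), where c is the cell containing k and d is the neighbour of c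
   with the minimal entry m, provided that m < k; None if c is a corner or
   k < m, in which case the insertion of k stops. *)
Definition next_exchange (la : seq nat) (k : 'I_(sumn la).+1) (T : filling la)
    : option (cell la * cell la) :=
  [pick p : cell la * cell la |
    [&& T p.1 == k, below_or_right p.1 p.2,
        [forall (e | below_or_right p.1 e), T p.2 <= T e] & T p.2 < k]].

Definition exchange (la : seq nat) (T : filling la) (c d : cell la)
    : filling la :=
  [ffun e => if e == c then T d else if e == d then T c else T e].

(* Exchanges until next_exchange stops; returns the final filling and the number
   of exchanges.  Each exchange moves k to a cell with larger i + j, so at most
   n - 1 exchanges occur and fuel n is never exhausted. *)
Fixpoint insert_rec (la : seq nat) (fuel : nat) (k : 'I_(sumn la).+1)
    (T : filling la) : filling la * nat :=
  if fuel is fuel'.+1 then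
    if next_exchange k T is Some (c, d) then
      let: (T', m) := insert_rec fuel' k (exchange T c d) in (T', m.+1)
    else (T, 0)
  else (T, 0).

Definition insert_entry (la : seq nat) (k : 'I_(sumn la).+1) (T : filling la)
    : filling la * nat :=
  insert_rec (sumn la) k T.

(* T_n together with the total number of exchanges; the inserted entries
   k_r = T (i_r, j_r) are read off the initial filling T. *)
Definition nps (la : seq nat) (T : filling la) : filling la * nat :=
  foldl (fun s c => let: (T', m) := insert_entry (T c) s.1 in (T', s.2 + m))
        (T, 0) (decreasing_cells la).

Definition nps_exchanges (la : seq nat) (T : filling la) : nat := (nps T).2.

Local Open Scope ring_scope.

Definition nps_complexity (la : seq nat) : rat :=
  (\sum_(T : filling la | is_tableau T) (nps_exchanges T)%:R)
  / ((sumn la)`!)%:R.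

Definition harmonic (m : nat) : rat := \sum_(1 <= l < m.+1) l%:R^-1.

(* Main.v *)
(* For two rows, record an intermediate tableau by the word that lists its
   entries in increasing order, true for row 1 and false for row 2.  After
   complete columns have been treated this is a ballot word, and inserting an
   entry acts on words through its rank only; the rank is uniform when the
   initial tableau is.  Inserting into both cells of a new column maps the
   uniform distribution on ballot words with q falses and p trues to the uniform
   distribution on those with q+1 falses and p+1 trues ([ballot_insert_sum]).
   The expected cost of that column is therefore a quotient of sums over ballot
   words, which satisfy Pascal-type recurrences in (p, q) with closed forms in
   terms of binomial coefficients and of the partial sums
   W(a, b) = sum_{k <= b} C(a+b+1, k).  Since
   W(a, b) / 2^b = sum_{j <= b} C(a+j, j) / 2^j, the stated formula satisfies
   the same recurrence along (p, q) -> (p+1, q+1), and at q = 0 both sides are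
   p(p-1)/4. *)

Require Import Defs.
From mathcomp Require Import all_boot all_order all_algebra.
From mathcomp Require Import zify ring.

Set Implicit Arguments.
Unset Strict Implicit.
Unset Printing Implicit Defensive.

Import Order.TTheory GRing.Theory Num.Theory.
Local Open Scope ring_scope.

(** * Ballot words, insertion into words, and sums over cut points *)

(* Turns into true the first false that breaks the ballot condition when h more
   trues than falses have been read; None if there is none. *)
Fixpoint flip (h : nat) (s : seq bool) : option (seq bool) :=
  match s with
  | [::] => None
  | true :: s' => omap (cons true) (flip h.+1 s')
  | false :: s' =>
      if h is h'.+1 then omap (cons false) (flip h' s') else Some (true :: s')
  end.

(* Inserting an entry k into row 1 (f = true) or row 2 (f = false) at the left
   end of the current tableau; s and t describe the entries smaller and larger
   than k.  In row 1, k moves right past all the trues of s, unless s has a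
   violation: then k drops to row 2 there, and the violating entry moves up. *)
Definition place (f : bool) (s t : seq bool) : seq bool :=
  if f then if flip 0 s is Some c then c ++ false :: t else s ++ true :: t
  else s ++ false :: t.

(** When a row 1 entry meets a violation, the trues and falses before it are equally many, say a.
    The entry makes a moves right, one move down, and one move for each later false, so the total is
    again the number of falses. *)
Definition cost (f : bool) (s : seq bool) : nat :=
  if f && ~~ flip 0 s then count id s else count negb s.

(** Words are generated by their last letter, so sums over them obey a Pascal-type recurrence. The
    guard empties the list above the diagonal. *)
Fixpoint ballot_words (p : nat) : nat -> seq (seq bool) :=
  match p with
  | 0 => fun q => if q is 0 then [:: [::]] else [::]
  | p'.+1 => fix ballot_words_row q :=
      match q with
      | 0 => [seq rcons b true | b <- ballot_words p' 0]
      | q'.+1 => if (q' <= p')%N then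
          [seq rcons b true | b <- ballot_words p' q]
          ++ [seq rcons b false | b <- ballot_words_row q'] else [::]
      end
  end.

(** A cut of the word is a rank of the inserted entry: the prefix holds the smaller entries, the
    suffix the larger ones. Summing over cuts is, up to normalization, averaging over a uniform
    rank. *)
Definition split_sum (F : seq bool -> seq bool -> rat) (b : seq bool) : rat :=
  \sum_(0 <= i < (size b).+1) F (take i b) (drop i b).

Lemma split_sum_nil F : split_sum F [::] = F [::] [::].
Proof. by rewrite /split_sum big_nat1. Qed.

Lemma split_sum_rcons F b x :
  split_sum F (rcons b x) =
    split_sum (fun s t => F s (rcons t x)) b + F (rcons b x) [::].
Proof.
rewrite /split_sum size_rcons big_nat_recr //=; congr (_ + _); last first.
  by rewrite -(size_rcons b x) take_size drop_size.
apply: eq_big_nat => i /andP[_ hi]; rewrite -cats1 take_cat drop_cat.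
rewrite -cats1; case: ltnP => // hi'.
have -> : i = size b by apply/eqP; rewrite eqn_leq hi' -ltnS hi.
by rewrite subnn /= cats0 take_size drop_size.
Qed.

Lemma eq_split_sum F G b :
  (forall s t, b = s ++ t -> F s t = G s t) -> split_sum F b = split_sum G b.
Proof.
by move=> h; apply: eq_big_nat => i _; apply: h; rewrite cat_take_drop.
Qed.

Lemma split_sumD F G b :
  split_sum (fun s t => F s t + G s t) b = split_sum F b + split_sum G b.
Proof. exact: big_split. Qed.

Lemma split_sum_const c b : split_sum (fun _ _ => c) b = c * (size b).+1%:R.
Proof. by rewrite /split_sum sumr_const_nat subn0 mulr_natr. Qed.

(** An appended letter creates a first violation only if it is a false read at surplus zero; an
    earlier violation is unaffected by it. *)
Lemma flip_rcons h s x :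
  flip h (rcons s x) =
    match flip h s with
    | Some c => Some (rcons c x)
    | None => if ~~ x && (h + count id s == count negb s)%N
              then Some (rcons s true) else None
    end.
Proof.
elim: s h => [|[] s IH] [|h] //=; rewrite ?IH; try clear IH;
  case: x => //=; (try by case: (flip _ _)); case: (flip _ _) => //=;
  (do ?case: eqP => ?) => //; lia.
Qed.

Lemma flip_catN h s t : flip h (s ++ t) = None -> flip h s = None.
Proof.
by elim: s h => [|[] s IH] [|h] //=; case e: (flip _ _) => //= _; rewrite IH.
Qed.

Lemma flip_size h s c : flip h s = Some c -> size c = size s.
Proof.
elim: s h c => [|[] s IH] [|h] c //=; first [by move=> [<-] |
  by case e: (flip _ _) => [d|] //= [<-] /=; rewrite (IH _ _ e)].
Qed.

Lemma ballot_words_lt p q : (p < q)%N -> ballot_words p q = [::].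
Proof. by case: p q => [|p] [|q] //=; rewrite ltnS => h; rewrite leqNgt h. Qed.

Lemma ballot_words_SS p q : (q <= p)%N -> ballot_words p.+1 q.+1 =
  [seq rcons b true | b <- ballot_words p q.+1]
  ++ [seq rcons b false | b <- ballot_words p.+1 q].
Proof. by move=> /= ->. Qed.

Lemma count_negb_rcons s x : count negb (rcons s x) = (count negb s + ~~ x)%N.
Proof. by rewrite -cats1 count_cat /= addn0. Qed.

Lemma count_id_rcons s x : count id (rcons s x) = (count id s + x)%N.
Proof. by rewrite -cats1 count_cat /= addn0. Qed.

Lemma ballot_wordsP p q b : b \in ballot_words p q ->
  [/\ flip 0 b = None, count id b = p & count negb b = q].
Proof.
elim: p q b => [|p IHp] q b.
  by case: q => //=; rewrite inE => /eqP ->.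
elim: q b => [|q IHq] b.
  move=> /mapP[c /IHp[h1 h2 h3] ->].
  by rewrite flip_rcons h1 /= count_negb_rcons count_id_rcons h2 h3 addn1.
case: (leqP q p) => [qp|pq]; last by rewrite ballot_words_lt.
rewrite ballot_words_SS // mem_cat => /orP[] /mapP[c].
  move=> /IHp[h1 h2 h3] ->.
  by rewrite flip_rcons h1 /= count_negb_rcons count_id_rcons h2 h3 addn1 addn0.
move=> /IHq[h1 h2 h3] ->.
rewrite flip_rcons h1 /= count_negb_rcons count_id_rcons h2 h3 addn1 addn0.
by split=> //; rewrite add0n; case: eqP => // e; lia.
Qed.

Lemma ballot_words_size p q b : b \in ballot_words p q -> size b = (p + q)%N.
Proof.
by case/ballot_wordsP=> _ <- <-; rewrite -(count_predC id b).
Qed.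

Definition ballot_sum p q (phi : seq bool -> rat) : rat :=
  \sum_(b <- ballot_words p q) phi b.

Lemma ballot_sum_lt p q phi : (p < q)%N -> ballot_sum p q phi = 0.
Proof. by move=> h; rewrite /ballot_sum ballot_words_lt // big_nil. Qed.

Lemma ballot_sum00 phi : ballot_sum 0 0 phi = phi [::].
Proof. by rewrite /ballot_sum /= big_seq1. Qed.

Lemma ballot_sumS0 p phi :
  ballot_sum p.+1 0 phi = ballot_sum p 0 (fun b => phi (rcons b true)).
Proof. by rewrite /ballot_sum /= big_map. Qed.

Lemma ballot_sumSS p q phi : (q <= p)%N ->
  ballot_sum p.+1 q.+1 phi = ballot_sum p q.+1 (fun b => phi (rcons b true))
    + ballot_sum p.+1 q (fun b => phi (rcons b false)).
Proof.
by move=> h; rewrite /ballot_sum ballot_words_SS // big_cat /= !big_map.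
Qed.

Lemma eq_ballot_sum p q phi psi :
  (forall b, flip 0 b = None -> count id b = p -> count negb b = q ->
    size b = (p + q)%N -> phi b = psi b) ->
  ballot_sum p q phi = ballot_sum p q psi.
Proof.
move=> h; apply: eq_big_seq => b hb.
by have [h1 h2 h3] := ballot_wordsP hb; apply: h (ballot_words_size hb).
Qed.

Lemma ballot_sumD p q phi psi :
  ballot_sum p q (fun b => phi b + psi b) =
    ballot_sum p q phi + ballot_sum p q psi.
Proof. exact: big_split. Qed.

Lemma ballot_sumZ p q c phi :
  ballot_sum p q (fun b => c * phi b) = c * ballot_sum p q phi.
Proof. by rewrite /ballot_sum mulr_sumr. Qed.

Definition ballot_number p q : rat := ballot_sum p q (fun=> 1).

Lemma ballot_sum_const p q c : ballot_sum p q (fun=> c) = c * ballot_number p q.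
Proof. by rewrite -ballot_sumZ mulr1. Qed.

(** * Uniformity on ballot words *)

(** This collects the insertions into a column in which one of the two new entries exceeds all
    others. If it is the row 1 entry, a flip decides the row of the last letter; if it is the row 2
    entry, the last letter is false. [phi] and [psi] evaluate the word without its last letter, true
    or false respectively. *)
Definition swap_kernel (phi psi : seq bool -> rat) (s t : seq bool) : rat :=
  (if flip 0 (s ++ false :: t) is Some c then psi c else phi (s ++ false :: t))
  + psi (s ++ true :: t).

Lemma swap_kernel_nil phi psi s : flip 0 s = None ->
  swap_kernel phi psi s [::] =
    (if count id s == count negb s then psi (rcons s true)
     else phi (rcons s false)) + psi (rcons s true).
Proof.
by rewrite /swap_kernel !cats1 flip_rcons => -> /=; rewrite add0n; case: eqP.
Qed.

Lemma swap_kernel_rcons_true phi psi s t :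
  swap_kernel phi psi s (rcons t true) =
    swap_kernel (fun b => phi (rcons b true)) (fun b => psi (rcons b true)) s t.
Proof.
rewrite /swap_kernel -!rcons_cons -!rcons_cat flip_rcons /=.
by case: (flip _ _).
Qed.

Lemma swap_kernel_rcons_false phi psi s t :
  swap_kernel phi psi s (rcons t false) =
    swap_kernel
      (fun b => if count id (s ++ t) == (count negb (s ++ t)).+1
                then psi (rcons b true) else phi (rcons b false))
      (fun b => psi (rcons b false)) s t.
Proof.
rewrite /swap_kernel -!rcons_cons -!rcons_cat flip_rcons /=.
case: (flip _ _) => //=; rewrite add0n !count_cat /= add0n addnA addn1.
by rewrite addSn; case: eqP.
Qed.

(* If b has p trues and q falses, inserting a false into b gives either a
   ballot word or a word that [flip] turns into a ballot word with one more
   true; the identity says that these, together with the insertions of a true,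
   cover every ballot word the same number of times. *)
Lemma swap_kernel_sum p q phi psi : (q <= p)%N ->
  ballot_sum p q (split_sum (swap_kernel phi psi)) =
    q.+1%:R * ballot_sum p q.+1 phi + p.+2%:R * ballot_sum p.+1 q psi.
Proof.
elim: p q phi psi => [|p IHp] q phi psi.
  rewrite leqn0 => /eqP->; rewrite ballot_sumS0 !ballot_sum00 split_sum_nil.
  rewrite swap_kernel_nil //= ballot_sum_lt // mulr0 add0r.
  by rewrite -[2%:R]/(1 + 1) mulrDl mul1r.
elim: q phi psi => [|q IHq] phi psi hqp.
  rewrite ballot_sumS0 (ballot_sumS0 p.+1) (ballot_sumSS _ (q := 0)) //.
  transitivity (ballot_sum p 0 (fun b =>
    split_sum (swap_kernel (fun b => phi (rcons b true))
                           (fun b => psi (rcons b true))) b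
    + (phi (rcons (rcons b true) false) + psi (rcons (rcons b true) true)))).
    apply: eq_ballot_sum => b h1 h2 h3 h4; rewrite split_sum_rcons.
    congr (_ + _).
      by apply: eq_split_sum => s t _; rewrite swap_kernel_rcons_true.
    rewrite swap_kernel_nil ?flip_rcons ?h1 //=.
    by rewrite count_id_rcons count_negb_rcons h2 h3 addn1.
  rewrite !ballot_sumD IHp // !ballot_sumS0 -[p.+3%:R]natr1.
  by ring.
rewrite (ballot_sumSS _ (q := q)) //.
pose phit b := phi (rcons b true); pose phif b := phi (rcons b false).
pose psit b := psi (rcons b true); pose psif b := psi (rcons b false).
(* Cuts before the last letter are reduced to the shorter word. If that letter is false and [p = q],
   an inserted false that causes no earlier flip exhausts the surplus, so the last letter itself
   flips; hence [psit] in place of [phif]. *)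
transitivity (ballot_sum p q.+1 (fun b =>
    split_sum (swap_kernel phit psit) b + swap_kernel phi psi (rcons b true) [::])
  + ballot_sum p.+1 q (fun b =>
    split_sum (swap_kernel (if p == q then psit else phif) psif) b
    + swap_kernel phi psi (rcons b false) [::])).
  congr (_ + _); apply: eq_ballot_sum => b h1 h2 h3 h4; rewrite split_sum_rcons.
    congr (_ + _).
    by apply: eq_split_sum => s t _; rewrite swap_kernel_rcons_true.
  congr (_ + _); apply: eq_split_sum => s t e.
  by rewrite swap_kernel_rcons_false -e h2 h3 eqSS; case: eqP.
rewrite (ballot_sumD p q.+1 (split_sum (swap_kernel phit psit))).
rewrite (ballot_sumD p.+1 q (split_sum (swap_kernel _ _))) addrACA.
rewrite (IHq _ _ (ltnW hqp)).
have -> : ballot_sum p q.+1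
    (fun b => swap_kernel phi psi (rcons b true) [::])
  + ballot_sum p.+1 q (fun b => swap_kernel phi psi (rcons b false) [::])
  = ballot_sum p.+1 q.+1 (if p == q then psit else phif)
    + ballot_sum p.+1 q.+1 psit.
  rewrite -(ballot_sumSS (fun b => swap_kernel phi psi b [::])) // -ballot_sumD.
  apply: eq_ballot_sum => b h1 h2 h3 h4.
  by rewrite swap_kernel_nil // h2 h3 eqSS; case: eqP.
rewrite (ballot_sumSS psi (q := q)); last by rewrite ltnW.
(* On the diagonal the sums over words with more falses than trues vanish; elsewhere the induction
   on [p] applies to them. *)
case: eqP => [e|/eqP ne].
  rewrite -e (ballot_sum_lt _ (ltnSn p)) (ballot_sum_lt _ (ltnSn p.+1)).
  by rewrite -/psit -/psif; ring.
have hq : (q < p)%N by rewrite ltn_neqAle eq_sym ne.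
rewrite IHp // (ballot_sumSS phi (q := q.+1)) // -/psit -/psif -/phit -/phif.
by ring.
Qed.

(** The bottom cell of a column is treated before the top one, so the row 2 entry is placed first
    and the row 1 entry is ranked against the enlarged word. *)
Definition ballot_insert (phi : seq bool -> rat) (b : seq bool) : rat :=
  split_sum (fun s t =>
    split_sum (fun s' t' => phi (place true s' t')) (place false s t)) b.

Lemma ballot_insert_nil phi :
  ballot_insert phi [::] = phi [:: true; false] *+ 2.
Proof.
by rewrite /ballot_insert split_sum_nil /split_sum /= big_ltn //= big_nat1.
Qed.

Lemma place_rcons f s t x : place f s (rcons t x) = rcons (place f s t) x.
Proof.
by rewrite /place; case: f; first case: (flip _ _) => [c|];
  rewrite -rcons_cons -rcons_cat.
Qed.

(** Either both new entries lie below the largest old one, whose letter [x] then stays last, or one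
    of them is the overall maximum. The second case is [swap_kernel]; the ballot hypothesis on
    [rcons b x] excludes flips in its prefixes. *)
Lemma ballot_insert_rcons phi b x : flip 0 (rcons b x) = None ->
  ballot_insert phi (rcons b x) =
    ballot_insert (fun c => phi (rcons c x)) b
    + split_sum (swap_kernel (fun c => phi (rcons c true))
                             (fun c => phi (rcons c false))) (rcons b x).
Proof.
move=> hb; pose last_place s t := phi (place true (place false s t) [::]).
have -> : split_sum (swap_kernel (fun c => phi (rcons c true))
                                 (fun c => phi (rcons c false))) (rcons b x)
    = split_sum last_place (rcons b x)
      + split_sum (fun s t => phi (rcons (place true s t) false)) (rcons b x).
  rewrite -split_sumD; apply: eq_split_sum => s t e.
  have hs : flip 0 s = None by apply: (@flip_catN 0 s t); rewrite -e.
  rewrite /swap_kernel /last_place /place /= hs.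
  by case: (flip 0 (s ++ _)) => [c|]; rewrite cats1.
rewrite /ballot_insert split_sum_rcons addrA.
have -> : place false (rcons b x) [::] = rcons (rcons b x) false.
  by rewrite -[RHS]cats1.
rewrite [X in _ + X = _]split_sum_rcons [split_sum last_place _]split_sum_rcons.
rewrite addrCA addrA [RHS]addrAC addrA.
congr (_ + _); last by rewrite /last_place -[rcons (rcons b x) false]cats1.
rewrite [X in _ = X + _]addrC -[RHS]addrA -split_sumD; congr (_ + _).
  by apply: eq_split_sum => s t _; rewrite place_rcons.
apply: eq_split_sum => s t _; rewrite place_rcons split_sum_rcons.
rewrite /last_place place_rcons; congr (_ + _).
by apply: eq_split_sum => s' t' _; rewrite place_rcons.
Qed.

(** The multiplicity does not depend on the word, so uniformity survives a column. The induction
    removes the last letter; [swap_kernel_sum] accounts for the cases where a new entry is the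
    maximum. *)
Lemma ballot_insert_sum p q phi : (q <= p)%N ->
  ballot_sum p q (ballot_insert phi) =
    q.+1%:R * p.+2%:R * ballot_sum p.+1 q.+1 phi.
Proof.
pose phit phi (b : seq bool) : rat := phi (rcons b true).
pose phif phi (b : seq bool) : rat := phi (rcons b false).
elim: p q phi => [|p IHp] q phi.
  rewrite leqn0 => /eqP->; rewrite ballot_sumSS // ballot_sumS0 !ballot_sum00.
  by rewrite ballot_insert_nil ballot_sum_lt //= add0r mul1r mulr_natl.
elim: q phi => [|q IHq] phi hqp.
  rewrite ballot_sumS0.
  transitivity (ballot_sum p 0 (ballot_insert (phit phi))
    + ballot_sum p.+1 0 (split_sum (swap_kernel (phit phi) (phif phi)))).
    rewrite ballot_sumS0 -ballot_sumD; apply: eq_ballot_sum => b h _ h' _.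
    by rewrite ballot_insert_rcons // flip_rcons h.
  rewrite IHp // swap_kernel_sum // (ballot_sumSS phi (q := 0)) //.
  by rewrite -/(phit phi) -/(phif phi) -[p.+3%:R]natr1; ring.
transitivity (ballot_sum p q.+1 (ballot_insert (phit phi))
    + ballot_sum p.+1 q (ballot_insert (phif phi))
    + ballot_sum p.+1 q.+1 (split_sum (swap_kernel (phit phi) (phif phi)))).
  rewrite !(ballot_sumSS _ (q := q)) // addrACA -!ballot_sumD.
  congr (_ + _); apply: eq_ballot_sum => b h h1 h2 _;
    by rewrite ballot_insert_rcons // flip_rcons h //= add0n; case: eqP => //;
      lia.
rewrite (IHq _ (ltnW hqp)) swap_kernel_sum // (ballot_sumSS phi (q := q.+1)) //.
rewrite -/(phit phi) -/(phif phi).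
case: (ltnP q p) => hq; first by rewrite IHp //; ring.
by rewrite !(@ballot_sum_lt p) ?ltnS // (@ballot_sum_lt p.+1 q.+2) ?ltnS //;
  ring.
Qed.

(** * Recurrences and closed forms for the cost of a column *)

Definition low_cost_sum p q : rat :=
  ballot_sum p q (split_sum (fun s _ => (cost false s)%:R)).

Definition top_cost (b : seq bool) : rat :=
  split_sum (fun s t => split_sum (fun s' _ => (cost true s')%:R)
                                  (place false s t)) b.

Definition top_cost_sum p q : rat := ballot_sum p q top_cost.

Lemma low_cost_sum0 p : low_cost_sum p 0 = 0.
Proof.
rewrite -(mul0r (ballot_number p 0)) -ballot_sum_const.
apply: eq_ballot_sum => b _ _ h _; rewrite -(mul0r (size b).+1%:R).
rewrite -split_sum_const; apply: eq_split_sum => s t e.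
move: h; rewrite e count_cat /cost /= => /eqP;
  rewrite addn_eq0 => /andP[/eqP-> _].
by [].
Qed.

Lemma low_cost_sumSS p q : (q <= p)%N -> low_cost_sum p.+1 q.+1 =
  low_cost_sum p q.+1 + low_cost_sum p.+1 q
  + q.+1%:R * ballot_number p.+1 q.+1.
Proof.
move=> hqp; rewrite -ballot_sum_const /low_cost_sum !(ballot_sumSS _ hqp).
rewrite [RHS]addrACA -!ballot_sumD.
congr (_ + _); apply: eq_ballot_sum => b _ h1 h2 _;
  by rewrite split_sum_rcons /cost /= count_negb_rcons h2 /= ?addn0 ?addn1.
Qed.

(** The case division is that of [ballot_insert_rcons]. A row 1 entry cutting a ballot word below a
    maximal row 2 entry meets no violation and only passes trues, which gives the term
    [count id s]. *)
Lemma top_cost_rcons b x : flip 0 (rcons b x) = None ->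
  top_cost (rcons b x) =
    top_cost b + split_sum (fun s t => (count id s)%:R
                   + (cost true (place false s t))%:R) (rcons b x).
Proof.
move=> hb; rewrite /top_cost split_sumD.
rewrite [in LHS]split_sum_rcons.
have -> : place false (rcons b x) [::] = rcons (rcons b x) false.
  by rewrite -[RHS]cats1.
rewrite [X in _ + X = _]split_sum_rcons.
rewrite [X in _ = _ + (_ + X)]split_sum_rcons addrCA.
rewrite [RHS]addrA [X in _ = X + _]addrC -[RHS]addrA; congr (_ + _).
  apply: eq_split_sum => s t e; rewrite /cost /=.
  by have -> : flip 0 s = None by apply: (@flip_catN 0 s t); rewrite -e.
rewrite addrA -split_sumD -[rcons (rcons b x) false]cats1; congr (_ + _).
by apply: eq_split_sum => s t _; rewrite place_rcons split_sum_rcons.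
Qed.

(** The first line sums the trues in prefixes: total prefix length minus the falses, which are
    [low_cost_sum]. The rest sums the cost of a maximal row 1 entry, evaluated by
    [swap_kernel_sum]. *)
Definition top_cost_step p q : rat :=
  (p + q)%:R * (p + q).+1%:R / 2%:R * ballot_number p q - low_cost_sum p q
  + (q.+1%:R * (p%:R * ballot_number p q.+1)
     + p.+2%:R * (q.+1%:R * ballot_number p.+1 q)
     - (p + q).+1%:R * q.+1%:R * ballot_number p q).

Lemma split_sum_size b :
  split_sum (fun s _ => (size s)%:R) b = (size b)%:R * (size b).+1%:R / 2%:R.
Proof.
elim/last_ind: b => [|b x IH]; first by rewrite split_sum_nil !mul0r.
by rewrite split_sum_rcons IH size_rcons -!natr1; field.
Qed.

Lemma top_cost_stepE p q : (q <= p)%N ->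
  ballot_sum p q (split_sum (fun s t => (count id s)%:R
                               + (cost true (place false s t))%:R))
  = top_cost_step p q.
Proof.
move=> hqp; rewrite /top_cost_step; set n := (p + q)%N.
pose cnt := split_sum (fun s _ => (count id s)%:R).
pose cst := split_sum (fun s t => (cost true (place false s t))%:R).
transitivity (ballot_sum p q cnt + ballot_sum p q cst).
  by rewrite -ballot_sumD; apply: eq_ballot_sum => b _ _ _ _;
    rewrite -split_sumD.
congr (_ + _); apply/eqP; rewrite eq_sym subr_eq; apply/eqP.
  rewrite -ballot_sum_const -ballot_sumD; apply: eq_ballot_sum => b _ _ _ hb.
  rewrite -[n]hb -split_sum_size -split_sumD; apply: eq_split_sum => s t _.
  by rewrite -natrD /cost /= (count_predC id).
(* A maximal row 1 entry costs [p] without a flip and [q.+1] with one. With these two constants,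
   [swap_kernel] is that cost plus [q.+1], and the subtracted term removes the excess over all
   cuts. *)
rewrite -!ballot_sum_const -(swap_kernel_sum (fun=> p%:R) (fun=> q.+1%:R) hqp).
rewrite -ballot_sumD; apply: eq_ballot_sum => b _ h1 h2 hb.
rewrite [n.+1%:R * _]mulrC -[n]hb -split_sum_const -split_sumD.
apply: eq_split_sum => s t e; rewrite /swap_kernel; congr (_ + _).
rewrite /cost /= -h1 -h2 e !count_cat /=.
by case: (flip _ _) => [c|] /=; rewrite ?addnS ?add0n.
Qed.

Lemma top_cost_sum00 : top_cost_sum 0 0 = 1.
Proof.
rewrite /top_cost_sum ballot_sum00 /top_cost split_sum_nil.
by rewrite /split_sum /= big_ltn // big_nat1 /cost /= add0r.
Qed.

Lemma top_cost_sumS0 p :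
  top_cost_sum p.+1 0 = top_cost_sum p 0 + top_cost_step p.+1 0.
Proof.
rewrite -top_cost_stepE // /top_cost_sum !ballot_sumS0 -ballot_sumD.
by apply: eq_ballot_sum => b h _ _ _; rewrite top_cost_rcons // flip_rcons h.
Qed.

Lemma top_cost_sumSS p q : (q <= p)%N -> top_cost_sum p.+1 q.+1 =
  top_cost_sum p q.+1 + top_cost_sum p.+1 q + top_cost_step p.+1 q.+1.
Proof.
move=> hqp; rewrite -top_cost_stepE // /top_cost_sum !(ballot_sumSS _ hqp).
rewrite [RHS]addrACA -!ballot_sumD.
congr (_ + _); apply: eq_ballot_sum => b h h1 h2 _;
  by rewrite top_cost_rcons // flip_rcons h //= add0n; case: eqP => //; lia.
Qed.

(** * Closed forms in binomial coefficients and their partial sums *)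

Ltac nat_neq0 := rewrite -?natrD ?nat1r -?natrD ?nat1r -?natrD ?pnatr_eq0; lia.

Definition binom_sum a b : rat := \sum_(0 <= k < b.+1) 'C((a + b).+1, k)%:R.

Lemma binom_addSr p q : 'C(p + q.+1, q.+1)%:R =
  'C(p + q, q)%:R * (p + q).+1%:R / q.+1%:R :> rat.
Proof.
apply/eqP; rewrite eq_sym -subr_eq0; apply/eqP.
have := mul_bin_diag (p + q).+1 q;
  rewrite /= => /(congr1 (fun n => n%:R : rat)).
rewrite !natrM addnS => h; have -> : 'C((p + q).+1, q.+1)%:R =
  q.+1%:R * 'C((p + q).+1, q.+1)%:R / q.+1%:R :> rat.
  by field; nat_neq0.
by rewrite -h; field; nat_neq0.
Qed.

Lemma binom_addSl p q : 'C(p.+1 + q, q)%:R =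
  'C(p + q, q)%:R * (p + q).+1%:R / p.+1%:R :> rat.
Proof.
have e n m : 'C(n + m, m) = 'C(m + n, n).
  by rewrite -(bin_sub (leq_addl n m)) addnK addnC.
by rewrite e binom_addSr (e p) (addnC p).
Qed.

Lemma binom_add_neq0 p q : 'C(p + q, q)%:R != 0 :> rat.
Proof. by rewrite pnatr_eq0 -lt0n bin_gt0 leq_addl. Qed.

Lemma binom_sum0 a : binom_sum a 0 = 1.
Proof. by rewrite /binom_sum big_nat1 bin0. Qed.

(** By Pascal's rule every ['C(n, k)] with [k < b] is counted twice and ['C(n, b)] once. *)
Lemma binom_sum_double n b : \sum_(0 <= k < b.+1) 'C(n.+1, k)%:R =
  2%:R * (\sum_(0 <= k < b) 'C(n, k)%:R) + 'C(n, b)%:R :> rat.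
Proof.
rewrite big_nat_recl // bin0.
rewrite (eq_bigr (fun k => 'C(n, k.+1)%:R + 'C(n, k)%:R)); last first.
  by move=> k _; rewrite binS natrD.
rewrite big_split /= addrA.
have -> : 1 + \sum_(0 <= k < b) 'C(n, k.+1)%:R
    = \sum_(0 <= k < b.+1) 'C(n, k)%:R :> rat by rewrite big_nat_recl // bin0.
by rewrite big_nat_recr //=; ring.
Qed.

Lemma binom_sumS a b : binom_sum a b.+1 =
  2%:R * binom_sum a b + 'C(a + b.+1, b.+1)%:R.
Proof. by rewrite /binom_sum binom_sum_double addnS. Qed.

Lemma binom_sumSl a b : binom_sum a.+1 b =
  2%:R * binom_sum a b - 'C(a.+1 + b, b)%:R.
Proof.
by rewrite /binom_sum binom_sum_double addSn (big_nat_recr b) //=; ring.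
Qed.

Lemma ballot_number_lt p q : (p < q)%N -> ballot_number p q = 0.
Proof. exact: ballot_sum_lt. Qed.

(** The range includes [q = p.+1], where both sides vanish, so that the recurrence may use the
    formula at [(p, q.+1)] when [q = p]. *)
Lemma ballot_numberE p q : (q <= p.+1)%N -> ballot_number p q =
  'C(p + q, q)%:R * (p%:R + 1 - q%:R) / p.+1%:R.
Proof.
elim: p q => [|p IHp].
  case=> [|[|]] // _; first by rewrite /ballot_number ballot_sum00.
  by rewrite ballot_number_lt // add0r subrr mulr0 mul0r.
elim=> [|q IHq] hq.
  rewrite /ballot_number ballot_sumS0 -/(ballot_number p 0) IHp // !bin0.
  by field; nat_neq0.
case: (leqP q p) => hqp; last first.
  have -> : q = p.+1 by lia.
  by rewrite ballot_number_lt // natr1 subrr mulr0 mul0r.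
rewrite /ballot_number ballot_sumSS // -/(ballot_number p q.+1).
rewrite -/(ballot_number p.+1 q) IHp // IHq; last by lia.
rewrite binom_addSr binom_addSr !binom_addSl.
by field; nat_neq0.
Qed.

(** Both sides satisfy the recurrence [low_cost_sumSS] and vanish at [q = p.+1]. Once everything is
    expressed through ['C(p + q, q)] and [binom_sum p q], the induction step is a rational
    identity. *)
Lemma low_cost_sumE p q : (q <= p.+1)%N -> low_cost_sum p q =
  q.+1%:R * (p + q).+1%:R * ballot_number p q / 2%:R
  - (p%:R + 1 - q%:R) * binom_sum p q / 2%:R.
Proof.
elim: p q => [|p IHp].
  case=> [|[|]] // _.
    by rewrite low_cost_sum0 binom_sum0 ballot_numberE // bin0.
  by rewrite /low_cost_sum ballot_sum_lt // ballot_number_lt // mulr0 subrr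
    !mul0r subr0.
elim=> [|q IHq] hq.
  rewrite low_cost_sum0 ballot_numberE // binom_sum0 bin0 addn0.
  by field; nat_neq0.
case: (leqP q p) => hqp; last first.
  have -> : q = p.+1 by lia.
  rewrite /low_cost_sum ballot_sum_lt // ballot_number_lt //.
  by rewrite natr1 subrr mulr0 !mul0r subr0.
rewrite low_cost_sumSS // IHp // IHq; last by lia.
rewrite !ballot_numberE //; try lia.
rewrite binom_sumSl !binom_sumS binom_sumSl.
rewrite binom_addSr binom_addSr !binom_addSl.
by field; nat_neq0.
Qed.

(* The closed form was found by interpolation. *)
Lemma top_cost_sumE p q : (q <= p.+1)%N -> top_cost_sum p q =
  ballot_number p q * (p%:R ^+ 3 / 2%:R + p%:R ^+ 2 * q%:R
    + p%:R * q%:R ^+ 2 / 2%:R + p%:R ^+ 2 / 2%:R - p%:R * q%:R / 2%:R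
    - q%:R ^+ 2 - 4%:R * p%:R - 5%:R * q%:R - 4%:R)
  + (p%:R + 1 - q%:R) * (p + q + 10)%:R * binom_sum p q / 2%:R.
Proof.
elim: p q => [|p IHp].
  case=> [|[|]] // _.
    by rewrite top_cost_sum00 binom_sum0 ballot_numberE // bin0; field.
  by rewrite /top_cost_sum ballot_sum_lt // ballot_number_lt //; ring.
elim=> [|q IHq] hq.
  rewrite top_cost_sumS0 IHp // /top_cost_step low_cost_sumE //.
  rewrite !ballot_numberE // !binom_sum0 !bin0 !addn0 addn1 bin1.
  by field; nat_neq0.
case: (leqP q p) => hqp; last first.
  have -> : q = p.+1 by lia.
  rewrite /top_cost_sum ballot_sum_lt // ballot_number_lt //.
  by rewrite natr1 subrr !mul0r addr0.
rewrite top_cost_sumSS // IHp // IHq; last by lia.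
rewrite /top_cost_step low_cost_sumE // !ballot_numberE //; try lia.
rewrite binom_sumSl !binom_sumS binom_sumSl.
rewrite !(binom_addSr, binom_addSl).
by field; nat_neq0.
Qed.

(** * The recurrence of the stated formula *)

(** Since W(a, i) / 2^i is one plus the inner sum of the stated double sum, this is the double sum
    plus the single sum of the stated formula. *)
Definition ratio_sum a b : rat :=
  \sum_(1 <= i < b.+1) binom_sum a i / (i%:R * 'C(a + i, i)%:R).

Lemma ratio_sumS a b : ratio_sum a b.+1 =
  ratio_sum a b + binom_sum a b.+1 / (b.+1%:R * 'C(a + b.+1, b.+1)%:R).
Proof. by rewrite /ratio_sum big_nat_recr. Qed.

(* The rational term was found by interpolation. *)
Lemma ratio_sum_diagonal p q : ratio_sum p.+1 q.+1 = ratio_sum p q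
  + 2%:R * (p%:R - q%:R) / ((p + q).+2%:R * (p + q).+1%:R)
    * (binom_sum p q / 'C(p + q, q)%:R)
  + (2%:R * q%:R ^+ 2 + 5%:R * q%:R + 4%:R + p%:R ^+ 2 + 3%:R * p%:R
     + p%:R * q%:R) / (p.+1%:R * q.+1%:R * (p + q).+2%:R).
Proof.
have c0 := binom_add_neq0 p; elim: q => [|q IHq].
  rewrite ratio_sumS /ratio_sum !big_geq // binom_sumSl !binom_sumS !binom_sum0.
  rewrite !addn1 !addn0 !bin1 !bin0.
  by field; nat_neq0.
rewrite ratio_sumS {}IHq ratio_sumS binom_sumSl !binom_sumS.
have := c0 q.
rewrite !(binom_addSr, binom_addSl) => cq0.
by field; rewrite cq0; nat_neq0.
Qed.

Lemma harmonicS m : harmonic m.+1 = harmonic m + m.+1%:R^-1.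
Proof. by rewrite /harmonic big_nat_recr. Qed.

(** The stated right-hand side with its sums rewritten through [binom_sum] and [ratio_sum], which is
    the form suited to the diagonal recurrence. *)
Definition avg_cost a b : rat :=
  a%:R * (a%:R - 1) / 4%:R + b%:R * (b%:R - 3%:R) / 4%:R
  + 2%:R * (binom_sum a b / 'C(a + b, b)%:R) - 2%:R
  + (1 + a%:R - b%:R)
    * (ratio_sum a b - (2%:R * harmonic a + harmonic b - 2%:R * harmonic (a - b))).

Lemma avg_cost0 a : avg_cost a 0 = a%:R * (a%:R - 1) / 4%:R.
Proof.
rewrite /avg_cost binom_sum0 bin0 subn0 /ratio_sum.
have -> : harmonic 0 = 0 by rewrite /harmonic big_geq.
rewrite big_geq //.
by field.
Qed.

Lemma ballot_number_neq0 p q : (q <= p)%N -> ballot_number p q != 0.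
Proof.
move=> hqp; rewrite ballot_numberE; last by lia.
rewrite !mulf_neq0 ?invr_eq0 ?binom_add_neq0 //; last by nat_neq0.
by rewrite natr1 -natrB; [nat_neq0 | lia].
Qed.

(** The two increments are the mean costs of the bottom and top insertions, over words and ranks.
    Along the diagonal [1 + a - b] and [harmonic (a - b)] stay constant, so [ratio_sum_diagonal]
    leaves only a rational identity in W(p, q) and the binomial coefficient. *)
Lemma avg_costSS p q : (q <= p)%N -> avg_cost p.+1 q.+1 = avg_cost p q
  + low_cost_sum p q / ((p + q).+1%:R * ballot_number p q)
  + top_cost_sum p q / ((p + q).+1%:R * (p + q).+2%:R * ballot_number p q).
Proof.
move=> hqp; have h0 : (p%:R + 1 - q%:R != 0 :> rat).
  by rewrite natr1 -natrB; [nat_neq0 | lia].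
have c0 := binom_add_neq0 p q.
rewrite low_cost_sumE ?top_cost_sumE; try lia.
rewrite /avg_cost ratio_sum_diagonal subSS !harmonicS ballot_numberE; last lia.
rewrite binom_sumSl !binom_sumS.
rewrite !(binom_addSr, binom_addSl).
by field; rewrite c0 h0; nat_neq0.
Qed.

Lemma binom_sum_geom a b :
  \sum_(1 <= j < b.+1) 'C(j + a, j)%:R / 2%:R ^+ j
    = binom_sum a b / 2%:R ^+ b - 1 :> rat.
Proof.
elim: b => [|b IHb]; first by rewrite big_geq // binom_sum0 expr0; field.
rewrite big_nat_recr //= IHb binom_sumS exprS (addnC b.+1).
by field; rewrite expf_neq0.
Qed.

Lemma avg_costE a b : avg_cost a b =
    a%:R * (a%:R - 1) / 4%:R + b%:R * (b%:R - 3%:R) / 4%:R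
    - 2%:R *
      (- (2%:R ^+ b / 'C(a + b, b)%:R
          * (\sum_(1 <= i < b.+1) 'C(i + a, i)%:R / 2%:R ^+ i + 1))
       + (- 1 - a%:R + b%:R) / 2%:R
         * (\sum_(1 <= i < b.+1)
              2%:R ^+ i / (i%:R * 'C(i + a, i)%:R)
              * (\sum_(1 <= j < i.+1) 'C(j + a, j)%:R / 2%:R ^+ j))
       - (1 + a%:R - b%:R) / 2%:R
         * (\sum_(1 <= i < b.+1) 2%:R ^+ i / (i%:R * 'C(i + a, i)%:R))
       + (1 + a%:R - b%:R)
         * (harmonic a + 2%:R^-1 * harmonic b - harmonic (a - b)%N)
       + 1).
Proof.
(* The inner sums start at 1 and so equal W(a, i) / 2^i - 1; the -1 splits off the single sum. *)
have -> : \sum_(1 <= i < b.+1) 2%:R ^+ i / (i%:R * 'C(i + a, i)%:R)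
    * (\sum_(1 <= j < i.+1) 'C(j + a, j)%:R / 2%:R ^+ j)
  = ratio_sum a b
    - \sum_(1 <= i < b.+1) 2%:R ^+ i / (i%:R * 'C(i + a, i)%:R) :> rat.
  rewrite -sumrB; apply: eq_big_nat => i /andP[i0 _].
  rewrite binom_sum_geom (addnC i).
  have := binom_add_neq0 a i => ci0.
  by field; rewrite ci0 expf_neq0 // pnatr_eq0; lia.
rewrite binom_sum_geom subrK /avg_cost.
have c0 := binom_add_neq0 a b.
by field; rewrite c0 expf_neq0.
Qed.

(** * Random permutations *)

Arguments place : simpl never.
Arguments cost : simpl never.

(* The entries are inserted from the last one to the first: the head of ks is
   the entry of the first cell in column order. *)
Fixpoint run (fl : seq bool) (ks : seq nat) : seq bool * nat :=
  match fl, ks with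
  | f :: fl', k :: ks' =>
      let: (w, c) := run fl' ks' in
      let i := count (fun x => x < k)%N ks' in
      (place f (take i w) (drop i w), (c + cost f (take i w))%N)
  | _, _ => ([::], 0)
  end.

(** All sequences of ranks are summed over, in place of all permutations of the entries. *)
Fixpoint run_sum (fl : seq bool) (phi : seq bool -> nat -> rat) : rat :=
  if fl is f :: fl' then
    run_sum fl' (fun w c =>
      split_sum (fun s t => phi (place f s t) (c + cost f s)%N) w)
  else phi [::] 0.

Lemma size_place f s t : size (place f s t) = (size s + size t).+1.
Proof.
rewrite /place; case: f; first case e: (flip 0 s) => [c|];
  by rewrite size_cat /= addnS ?(flip_size e).
Qed.

Lemma eq_run_sum fl phi psi :
  (forall w c, size w = size fl -> phi w c = psi w c) ->
  run_sum fl phi = run_sum fl psi.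
Proof.
elim: fl phi psi => [|f fl IH] phi psi h /=; first exact: h.
apply: IH => w c hw; apply: eq_split_sum => s t e; apply: h.
by rewrite size_place -size_cat -e hw.
Qed.

Lemma run_sum_bigD (I : Type) (r : seq I) fl phi :
  run_sum fl (fun w c => \sum_(i <- r) phi i w c) =
    \sum_(i <- r) run_sum fl (phi i).
Proof.
elim: fl phi => [|f fl IH] phi //=; rewrite -IH; apply: eq_run_sum => w c _.
exact: exchange_big.
Qed.

Lemma run_sumD fl phi psi :
  run_sum fl (fun w c => phi w c + psi w c) = run_sum fl phi + run_sum fl psi.
Proof.
elim: fl phi psi => [|f fl IH] phi psi //=; rewrite -IH;
  apply: eq_run_sum => w c _.
exact: split_sumD.
Qed.

Lemma run_sumZ fl a phi :
  run_sum fl (fun w c => a * phi w c) = a * run_sum fl phi.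
Proof.
elim: fl phi => [|f fl IH] phi //=; rewrite -IH; apply: eq_run_sum => w c _.
by rewrite /split_sum mulr_sumr.
Qed.

(** After sorting, the entry at index i has exactly i smaller ones. *)
Lemma big_count_lt (xs : seq nat) (g : nat -> rat) : uniq xs ->
  \sum_(x <- xs) g (count (fun y => y < x)%N xs) = \sum_(0 <= i < size xs) g i.
Proof.
move=> xs_uniq; pose s := sort leq xs.
have s_sorted : sorted ltn s.
  by rewrite ltn_sorted_uniq_leq sort_uniq xs_uniq sort_sorted //;
    apply: leq_total.
have s_perm : perm_eq s xs by rewrite perm_sort.
rewrite -(perm_big _ s_perm) (big_nth 0%N) (perm_size s_perm).
apply: eq_big_nat => i /andP[_ hi]; congr g.
rewrite -(permP s_perm) -[LHS]/(count (fun y => y < nth 0 s i)%O s).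
by rewrite Order.PreorderTheory.count_lt_nth // (perm_size s_perm).
Qed.

(** Fixing the head fixes its rank, and the tail runs over all permutations of the remaining values.
    By induction the tail contributes a sum that depends only on the number of values, so the rank
    of the head is independent of it. *)
Lemma sum_permutations_run fl (xs : seq nat) phi :
  uniq xs -> size fl = size xs ->
  \sum_(ks <- permutations xs) phi (run fl ks).1 (run fl ks).2 = run_sum fl phi.
Proof.
elim: fl xs phi => [|f fl IH] xs phi xs_uniq hsz.
  by case: xs hsz {xs_uniq} => //= _; rewrite big_seq1.
have hsz0 : (0 < size xs)%N by rewrite -hsz.
rewrite (perm_big _ (permutationsE hsz0)) big_allpairs_dep /= undup_id //.
pose step i w c := phi (place f (take i w) (drop i w)) (c + cost f (take i w))%N.
transitivity (\sum_(x <- xs) run_sum fl (step (count (fun y => y < x)%N xs))).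
  apply: eq_big_seq => x hx; rewrite -(IH (rem x xs)) ?rem_uniq //; last first.
    by rewrite size_rem // -hsz.
  apply: eq_big_seq => t; rewrite mem_permutations => /permP ht.
  rewrite ht count_rem hx ltnn subn0 /=.
  by case: (run fl t) => w c.
rewrite (big_count_lt (fun i => run_sum fl (step i))) //.
rewrite -run_sum_bigD -hsz /=; apply: eq_run_sum => w c hw.
by rewrite /split_sum hw.
Qed.

Fixpoint shape_flags d q : seq bool :=
  if q is q'.+1 then true :: false :: shape_flags d q' else nseq d true.

Lemma size_shape_flags d q : size (shape_flags d q) = (q + d + q)%N.
Proof. by elim: q => [|q IH] /=; rewrite ?size_nseq ?addn0 // IH; lia. Qed.

Lemma ballot_words0 p : ballot_words p 0 = [:: nseq p true].
Proof. by elim: p => //= p ->; 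
  rewrite /= -cats1 -[[:: true]]/(nseq 1 true) -nseqD addn1. Qed.

Lemma flip_nseq h d : flip h (nseq d true) = None.
Proof. by elim: d h => //= d IH h; rewrite IH. Qed.

Lemma ballot_insert1 b :
  ballot_insert (fun=> 1) b = (size b).+1%:R * (size b).+2%:R.
Proof.
rewrite mulrC -split_sum_const; apply: eq_split_sum => s t ->.
by rewrite split_sum_const mul1r size_place size_cat.
Qed.

(** The final word is uniform on ballot words, each arising from the same share of the n! rank
    sequences. The single-cell columns give one word only; each full column is
    [ballot_insert_sum]. *)
Lemma run_sum_shape_word d q phi :
  run_sum (shape_flags d q) (fun w _ => phi w) =
    (q + d + q)`!%:R / ballot_number (q + d) q * ballot_sum (q + d) q phi.
Proof.
elim: q phi => [|q IHq] phi.
  rewrite !add0n addn0 /ballot_number /ballot_sum ballot_words0 !big_seq1 divr1.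
  elim: d phi => [|d IHd] phi /=; first by rewrite mul1r.
  rewrite IHd /split_sum size_nseq.
  rewrite (eq_big_nat _ _ (F2 := fun=> phi (nseq d.+1 true))); last first.
    move=> i /andP[_]; rewrite ltnS => hi; congr phi.
    rewrite take_nseq // drop_nseq /place flip_nseq.
    by rewrite -[true :: nseq _ true]/(nseq (d - i).+1 true) -nseqD addnS subnKC.
  by rewrite sumr_const_nat subn0 factS natrM -mulr_natl; ring.
pose n := (q + d + q)%N; pose p := (q + d)%N.
transitivity (n`!%:R / ballot_number p q * ballot_sum p q (ballot_insert phi)).
  exact: IHq.
have hqp : (q <= p)%N by rewrite leq_addr.
rewrite -[(_ + q.+1)%N]/(p.+1 + q.+1)%N addSn addnS -/n !factS !natrM.
(* Taking the constant function 1 in [ballot_insert_sum] relates consecutive ballot numbers, which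
   renormalizes the weight. *)
have e : n.+1%:R * n.+2%:R * ballot_number p q
    = q.+1%:R * p.+2%:R * ballot_number p.+1 q.+1.
  rewrite -ballot_insert_sum // -ballot_sum_const.
  by apply: eq_ballot_sum => b _ _ _ hb; rewrite ballot_insert1 hb.
have n0 := ballot_number_neq0 hqp.
have n1 : ballot_number p.+1 q.+1 != 0 by apply: ballot_number_neq0.
rewrite ballot_insert_sum // -[RHS]mulrA [(ballot_number p.+1 _)^-1 * _]mulrC.
have -> : q.+1%:R * p.+2%:R = n.+1%:R * n.+2%:R * ballot_number p q
    / ballot_number p.+1 q.+1 by rewrite e mulfK.
by field; rewrite n0 n1.
Qed.

Lemma run_sum_shape_cost d q :
  run_sum (shape_flags d q) (fun _ c => c%:R) =
    (q + d + q)`!%:R * avg_cost (q + d) q.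
Proof.
elim: q => [|q IHq].
  rewrite !add0n addn0 avg_cost0.
  elim: d => [|d IHd]; first by rewrite /= !mul0r mulr0.
  transitivity (run_sum (nseq d true) (fun w c => d.+1%:R * c%:R)
     + run_sum (shape_flags d 0)
         (fun w _ => split_sum (fun s _ => (cost true s)%:R) w)).
    rewrite -run_sumD /=; apply: eq_run_sum => w c; rewrite size_nseq => hw.
    rewrite mulrC -hw -split_sum_const -split_sumD;
      apply: eq_split_sum => s t _.
    by rewrite natrD.
  rewrite run_sumZ IHd run_sum_shape_word !add0n addn0.
  rewrite /ballot_number /ballot_sum ballot_words0 !big_seq1 divr1.
  have -> : split_sum (fun s _ => (cost true s)%:R) (nseq d true)
      = split_sum (fun s _ => (size s)%:R) (nseq d true).
    rewrite /split_sum size_nseq; apply: eq_big_nat => i /andP[_].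
    rewrite ltnS => hi; rewrite take_nseq // /cost flip_nseq /= size_nseq.
    by rewrite count_nseq mul1n.
  rewrite split_sum_size size_nseq factS natrM -natr1.
  by field.
pose n := (q + d + q)%N; pose p := (q + d)%N.
have hqp : (q <= p)%N by rewrite leq_addr.
(* The earlier cost is repeated for all [n.+1 * n.+2] pairs of ranks, and the bottom cost for the
   [n.+2] ranks of the top entry. *)
transitivity (run_sum (shape_flags d q) (fun _ c => n.+1%:R * n.+2%:R * c%:R)
  + run_sum (shape_flags d q) (fun w _ =>
      n.+2%:R * split_sum (fun s _ => (cost false s)%:R) w + top_cost w)).
  rewrite -run_sumD /=; apply: eq_run_sum => w c;
    rewrite size_shape_flags -/n => hw.
  transitivity (split_sum (fun s t => n.+2%:R * c%:R + n.+2%:R * (cost false s)%:R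
    + split_sum (fun s' _ => (cost true s')%:R) (place false s t)) w).
    apply: eq_split_sum => s t e; rewrite -mulrDr -natrD mulrC.
    have <- : size (place false s t) = n.+1
      by rewrite size_place -size_cat -e hw.
    by rewrite -split_sum_const -split_sumD; apply: eq_split_sum => s' t' _;
       rewrite -natrD.
  rewrite !split_sumD split_sum_const hw -addrA /top_cost; congr (_ + _).
    by ring.
  by congr (_ + _); rewrite /split_sum mulr_sumr.
rewrite run_sumZ IHq run_sum_shape_word ballot_sumD ballot_sumZ.
rewrite -/(low_cost_sum _ _) -/(top_cost_sum _ _) -/p -/n.
rewrite -[(q.+1 + d)%N]/p.+1 avg_costSS // addSn addnS -/n !factS !natrM.
have n0 := ballot_number_neq0 hqp.
by field; rewrite n0; nat_neq0.
Qed.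

(** * The algorithm on two-row fillings *)

Section TwoRowSimulation.

Local Open Scope nat_scope.

Lemma mem_diagram2 l1 l2 i j : ((i, j) \in diagram [:: l1; l2]) =
  (i == 1) && (0 < j <= l1) || (i == 2) && (0 < j <= l2).
Proof.
rewrite /diagram /= cats0 mem_cat; congr (_ || _); apply/mapP/idP => [[x]|];
  rewrite ?mem_iota ?add1n ?ltnS.
- by move=> h [-> ->]; rewrite eqxx.
- by case/andP=> /eqP-> h; exists j; rewrite // mem_iota add1n ltnS.
- by move=> h [-> ->]; rewrite eqxx.
- by case/andP=> /eqP-> h; exists j; rewrite // mem_iota add1n ltnS.
Qed.

Lemma cell_exists la x : x \in diagram la -> exists c : cell la, ssval c = x.
Proof. by move=> h; exists (SeqSub h). Qed.

Definition entry (R1 R2 : seq nat) (x : nat * nat) : nat :=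
  nth 0 (if x.1 == 1 then R1 else R2) x.2.-1.

Definition shows l1 l2 (T : filling [:: l1; l2]) (R1 R2 : seq nat) : Prop :=
  [/\ size R1 = l1, size R2 = l2, uniq (R1 ++ R2)
    & forall c, T c = entry R1 R2 (ssval c) :> nat].

Lemma shows_inj l1 l2 (T : filling [:: l1; l2]) R1 R2 :
  shows T R1 R2 -> injective T.
Proof.
case=> h1 h2 hu hT c d /(congr1 val) /= e; apply: val_inj => /=.
(* Each cell is recovered from its position in [R1 ++ R2], so injectivity follows from the absence
   of repetitions there. *)
have pos x : x \in diagram [:: l1; l2] -> exists2 p,
    p < size (R1 ++ R2) & entry R1 R2 x = nth 0 (R1 ++ R2) p /\
    x = if p < l1 then (1, p.+1) else (2, (p - l1).+1).
  case: x => i j; rewrite mem_diagram2 /entry size_cat h1 h2.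
  case/orP=> /andP[/eqP-> /andP[j0 hj]] /=.
    exists j.-1; [lia | rewrite nth_cat h1]; have -> : j.-1 < l1 by lia.
    by split=> //; rewrite prednK.
  exists (l1 + j.-1); [lia | rewrite nth_cat h1 ltnNge leq_addr /=].
  by rewrite addKn prednK.
have [p hp [ep xp]] := pos _ (ssvalP c);
  have [q hq [eq xq]] := pos _ (ssvalP d).
move: e; rewrite !hT ep eq => /eqP; rewrite nth_uniq // => /eqP epq.
by rewrite xp xq epq.
Qed.

Lemma next_exchange_some la (k : 'I_(sumn la).+1) (T : filling la) c d :
  injective T -> T c = k -> below_or_right c d ->
  (forall e, below_or_right c e -> T d <= T e) -> T d < k ->
  next_exchange k T = Some (c, d).
Proof.
move=> injT Tc bcd dmin dk; rewrite /next_exchange;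
  case: pickP => [[c' d']|] /=.
  case/and4P=> /eqP ec bd /forallP hd _.
  have e1 : c' = c by apply: injT; rewrite ec Tc.
  subst c'; congr (Some (_, _)); apply: injT; apply/val_inj/eqP.
  by rewrite eqn_leq dmin // (implyP (hd d)).
move/(_ (c, d)) => /= /negbT/negP[]; rewrite Tc eqxx bcd dk andbT /=.
by apply/forallP => e; apply/implyP/dmin.
Qed.

Lemma next_exchange_none la (k : 'I_(sumn la).+1) (T : filling la) c :
  injective T -> T c = k -> (forall e, below_or_right c e -> k <= T e) ->
  next_exchange k T = None.
Proof.
move=> injT Tc h; rewrite /next_exchange; case: pickP => [[c' d']|] //=.
case/and4P=> /eqP ec bd _; have e1 : c' = c by apply: injT; rewrite ec Tc.
by subst c'; rewrite ltnNge h.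
Qed.

(** Any fuel of at least [m] is allowed, so that exchanges, each consuming one unit, can be chained.
    Fuel exactly [m] also works, since exhaustion returns the current filling. *)
Definition inserts (k : nat) (R1 R2 R1' R2' : seq nat) (m : nat) : Prop :=
  forall l1 l2 (T : filling [:: l1; l2]) (x : 'I_(sumn [:: l1; l2]).+1) fuel,
  shows T R1 R2 -> x = k :> nat -> m <= fuel ->
  exists2 T', insert_rec fuel x T = (T', m) & shows T' R1' R2'.

Lemma inserts_stop k c R1 R2 :
  c \in diagram [:: size R1; size R2] -> entry R1 R2 c = k ->
  (forall e, e \in diagram [:: size R1; size R2] ->
     e = (c.1.+1, c.2) \/ e = (c.1, c.2.+1) -> k <= entry R1 R2 e) ->
  inserts k R1 R2 R1 R2 0.
Proof.
move=> hc ck hmin l1 l2 T x fuel hs xk _; have injT := shows_inj hs.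
case: (hs) => h1 h2 _ hT; rewrite {}h1 {}h2 in hc hmin.
have [c' ec] := cell_exists hc.
exists T => //; case: fuel => //= fuel;
  rewrite (@next_exchange_none _ _ _ c') //.
  by apply: val_inj; rewrite /= hT ec ck.
move=> e; rewrite /below_or_right /row_of /col_of ec xk hT => h.
apply: hmin; first exact: ssvalP.
by case/orP: h => /eqP ->; [left | right].
Qed.

Lemma inserts_step k c d R1 R2 R1' R2' S1 S2 m :
  c \in diagram [:: size R1; size R2] -> d \in diagram [:: size R1; size R2] ->
  d = (c.1.+1, c.2) \/ d = (c.1, c.2.+1) ->
  entry R1 R2 c = k -> entry R1 R2 d < k ->
  (forall e, e \in diagram [:: size R1; size R2] ->
     e = (c.1.+1, c.2) \/ e = (c.1, c.2.+1) ->
       entry R1 R2 d <= entry R1 R2 e) ->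
  size R1' = size R1 -> size R2' = size R2 ->
  perm_eq (R1' ++ R2') (R1 ++ R2) ->
  (forall e, e \in diagram [:: size R1; size R2] -> entry R1' R2' e =
     if e == c then entry R1 R2 d else if e == d then entry R1 R2 c
     else entry R1 R2 e) ->
  inserts k R1' R2' S1 S2 m -> inserts k R1 R2 S1 S2 m.+1.
Proof.
move=> hc hd hcd ck dk hmin s1 s2 hp hex IH l1 l2 T x [|fuel] // hs xk hm.
have injT := shows_inj hs; case: (hs) => h1 h2 hu hT.
rewrite h1 h2 in hc hd hmin hex s1 s2.
have [c' ec] := cell_exists hc; have [d' ed] := cell_exists hd.
have bor e : below_or_right c' e ->
    ssval e = (c.1.+1, c.2) \/ ssval e = (c.1, c.2.+1).
  rewrite /below_or_right /row_of /col_of ec.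
  by case/orP=> /eqP ->; [left | right].
rewrite /= (@next_exchange_some _ _ _ c' d') //; first last.
- by rewrite hT ed xk.
- by move=> e /bor he; rewrite !hT ed; apply: hmin => //; apply: ssvalP.
- rewrite /below_or_right /row_of /col_of ec ed.
  by case: hcd => ->; rewrite eqxx ?orbT.
- by apply: val_inj; rewrite /= hT ec ck.
have hs' : shows (exchange T c' d') R1' R2'.
  split=> //; first by rewrite (perm_uniq hp).
  move=> e; rewrite ffunE hex; last exact: ssvalP.
  rewrite -ec -ed -!hT -!val_eqE /=.
  by case: ifP => // _; case: ifP.
have [T' -> hT'] := IH l1 l2 _ x fuel hs' xk hm.
by exists T'.
Qed.

Lemma nth_cat_size (A B : seq nat) i : nth 0 (A ++ B) (size A + i) = nth 0 B i.
Proof. by rewrite nth_cat ltnNge leq_addr addKn. Qed.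

Lemma nth_cat_size0 (A B : seq nat) x : nth 0 (A ++ x :: B) (size A) = x.
Proof. by rewrite -[size A]addn0 nth_cat_size. Qed.

Lemma nth_cat_size1 (A B : seq nat) x y :
  nth 0 (A ++ x :: y :: B) (size A).+1 = y.
Proof. by rewrite -addn1 nth_cat_size. Qed.

Lemma nth_cat_change (A B B' : seq nat) i : i != size A ->
  (forall j, nth 0 B j.+1 = nth 0 B' j.+1) ->
  nth 0 (A ++ B) i = nth 0 (A ++ B') i.
Proof.
move=> hi h; rewrite !nth_cat; case: ltnP => // hAi.
by case e: (i - size A) => [|j] //; move: hi; rewrite neq_ltn; lia.
Qed.

Lemma nth_cat_swap (A U : seq nat) x y i : i != size A -> i != (size A).+1 ->
  nth 0 (A ++ x :: y :: U) i = nth 0 (A ++ y :: x :: U) i.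
Proof.
move=> h1 h2; rewrite !nth_cat; case: ltnP => // hAi.
by case e: (i - size A) => [|[|j]] //; move/eqP: h1; move/eqP: h2; lia.
Qed.

(** The default [k] of [head] makes the first condition vacuous at the end of the row; the guard on
    sizes does the same where row 2 has no cell below. *)
Lemma inserts_stop1 k A U R2 :
  k <= head k U -> (size A < size R2 -> k <= nth 0 R2 (size A)) ->
  inserts k (A ++ k :: U) R2 (A ++ k :: U) R2 0.
Proof.
move=> hU hR; apply: (@inserts_stop k (1, (size A).+1)).
- by rewrite mem_diagram2 /= size_cat /= addnS ltnS leq_addr.
- by rewrite /entry /= nth_cat_size0.
- move=> e he [] ee; move: he; rewrite {e}ee;
  rewrite mem_diagram2 /= /entry /= ?orbF; first exact: hR.
  rewrite size_cat /= -[(size A).+1]addn1 nth_cat_size /=; case: U hU => //=;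
    lia.
Qed.

Lemma inserts_right1 k u A U R2 S1 S2 m :
  u < k -> (size A < size R2 -> u <= nth 0 R2 (size A)) ->
  inserts k (rcons A u ++ k :: U) R2 S1 S2 m ->
  inserts k (A ++ k :: u :: U) R2 S1 S2 m.+1.
Proof.
rewrite cat_rcons => uk hR.
apply: (@inserts_step k (1, (size A).+1) (1, (size A).+2)).
- rewrite mem_diagram2 /= size_cat /=; lia.
- rewrite mem_diagram2 /= size_cat /=; lia.
- by right.
- by rewrite /entry /= nth_cat_size0.
- by rewrite /entry /= nth_cat_size1.
- have eu : entry (A ++ k :: u :: U) R2 (1, (size A).+2) = u.
    by rewrite /entry /= nth_cat_size1.
  rewrite eu => e he [] ee; move: he; rewrite {e}ee ?eu // mem_diagram2.
  exact: hR.
- by rewrite !size_cat.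
- by [].
- by apply/permP => a; rewrite !count_cat /=; lia.
- move=> [i j]; rewrite mem_diagram2 /entry /= !xpair_eqE.
  case/orP=> /andP[/eqP-> /andP[j0 _]] //=.
  case: eqP => [->|h1]; first by rewrite nth_cat_size0 nth_cat_size1.
  case: eqP => [->|h2]; first by rewrite nth_cat_size0 nth_cat_size1.
  by apply: nth_cat_swap; apply/eqP; lia.
Qed.

Lemma inserts_stop2 k A V R1 :
  k <= head k V -> inserts k R1 (A ++ k :: V) R1 (A ++ k :: V) 0.
Proof.
move=> hV; apply: (@inserts_stop k (2, (size A).+1)).
- rewrite mem_diagram2 /= size_cat /=; lia.
- by rewrite /entry /= nth_cat_size0.
- move=> e he [] ee; move: he; rewrite {e}ee;
  rewrite mem_diagram2 //= /entry /= size_cat /=.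
  rewrite -[(size A).+1]addn1 nth_cat_size /=; case: V hV => //=; lia.
Qed.

Lemma inserts_right2 k v A V R1 S1 S2 m : v < k ->
  inserts k R1 (rcons A v ++ k :: V) S1 S2 m ->
  inserts k R1 (A ++ k :: v :: V) S1 S2 m.+1.
Proof.
rewrite cat_rcons => vk.
apply: (@inserts_step k (2, (size A).+1) (2, (size A).+2)).
- rewrite mem_diagram2 /= size_cat /=; lia.
- rewrite mem_diagram2 /= size_cat /=; lia.
- by right.
- by rewrite /entry /= nth_cat_size0.
- by rewrite /entry /= nth_cat_size1.
- by move=> e he [] ee; move: he; rewrite {e}ee //; rewrite mem_diagram2.
- by [].
- by rewrite !size_cat.
- by apply/permP => a; rewrite !count_cat /=; lia.
- move=> [i j]; rewrite mem_diagram2 /entry /= !xpair_eqE.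
  case/orP=> /andP[/eqP-> /andP[j0 _]] //=.
  case: eqP => [->|h1]; first by rewrite nth_cat_size0 nth_cat_size1.
  case: eqP => [->|h2]; first by rewrite nth_cat_size0 nth_cat_size1.
  by apply: nth_cat_swap; apply/eqP; lia.
Qed.

Lemma inserts_down k v A1 U A2 V S1 S2 m : size A1 = size A2 ->
  v < k -> v <= head v U ->
  inserts k (A1 ++ v :: U) (A2 ++ k :: V) S1 S2 m ->
  inserts k (A1 ++ k :: U) (A2 ++ v :: V) S1 S2 m.+1.
Proof.
move=> hA vk hU.
have ek x W : nth 0 (A1 ++ x :: W) (size A1) = x by exact: nth_cat_size0.
have ev x W : nth 0 (A2 ++ x :: W) (size A1) = x.
  by rewrite hA nth_cat_size0.
apply: (@inserts_step k (1, (size A1).+1) (2, (size A1).+1)).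
- rewrite mem_diagram2 /= size_cat /=; lia.
- rewrite mem_diagram2 /= !size_cat /=; lia.
- by left.
- by rewrite /entry /= ek.
- by rewrite /entry /= ev.
- move=> e he [] ee; move: he; rewrite {e}ee //=;
  rewrite mem_diagram2 /entry //= ev size_cat /=.
  rewrite -[(size A1).+1]addn1 nth_cat_size /=; case: (U) hU => //=; lia.
- by rewrite !size_cat.
- by rewrite !size_cat.
- by apply/permP => a; rewrite !count_cat /=; lia.
- move=> [i j]; rewrite mem_diagram2 /entry /= !xpair_eqE ek ev.
  case/orP=> /andP[/eqP-> /andP[j0 _]] //=.
    case: eqP => [->|h1]; first by rewrite ek.
    by apply: nth_cat_change => //; apply/eqP; lia.
  case: eqP => [->|h1]; first by rewrite ev.
  by apply: nth_cat_change => //; apply/eqP; lia.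
Qed.

Lemma inserts_slide k A V1 V2 R1 :
  all (fun v => v < k) V1 -> k <= head k V2 ->
  inserts k R1 (A ++ k :: V1 ++ V2) R1 (A ++ V1 ++ k :: V2) (size V1).
Proof.
elim: V1 A => [|v V1 IH] A /=; first by move=> _; apply: inserts_stop2.
case/andP=> vk hV1 hV2; apply: inserts_right2 => //.
by rewrite -(cat_rcons v A); apply: IH.
Qed.

(** This makes the truncated subtraction in the exchange count of [inserts_row1] exact, and excludes
    flips in words without false. *)
Lemma flip_count h s : flip h s -> h < count negb s.
Proof.
by elim: s h => [|[] s IH] [|h] //= hs;
  [have := IH 1 | have := IH h.+2 | have := IH h];
  move: hs; case: (flip _ s) => //= c _ /(_ isT); lia.
Qed.

Lemma all_le_head (k : nat) V : all (fun v => k < v) V -> k <= head k V.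
Proof. by case: V => //= v V /andP[/ltnW]. Qed.

Lemma all_nth_ge (k : nat) A V n : all (fun v => k < v) V ->
  size A <= n -> n < size (A ++ V) -> k <= nth 0 (A ++ V) n.
Proof.
move=> /all_nthP h hA; rewrite size_cat => hn; rewrite nth_cat ltnNge hA /=.
by apply/ltnW/h; lia.
Qed.

Lemma all_mask_gt (z : nat) m s : all (fun v => z < v) s ->
  all (fun v => z < v) (mask m s).
Proof. by move=> /allP h; apply/allP => x /mem_mask /h. Qed.

(* Here k has moved right past h more entries than the number of row 2 entries
   already read, so the entry below k is the one of index h in the part of row 2
   that follows A2; reading s one letter at a time is an induction on s. *)
Lemma inserts_row1 h s zs k A1 A2 U2 V2 :
  sorted ltn zs -> size s = size zs -> all (fun z => z < k) zs ->
  all (fun z => k < z) U2 -> all (fun z => k < z) V2 ->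
  size A1 = size A2 + h ->
  inserts k (A1 ++ k :: mask s zs ++ U2) (A2 ++ mask (map negb s) zs ++ V2)
    (A1 ++ if flip h s is Some c then mask c zs ++ U2 else mask s zs ++ k :: U2)
    (A2 ++ if flip h s is Some c then mask (map negb c) zs ++ k :: V2
           else mask (map negb s) zs ++ V2)
    (if flip h s then count negb s - h else count id s).
Proof.
elim: s h zs A1 A2 => [|b s IH] h [|z zs] A1 A2 //=.
  move=> _ _ _ hU hV hA; apply: inserts_stop1; first exact: all_le_head.
  by move=> hn; apply: all_nth_ge => //; rewrite hA leq_addr.
move=> zs_sorted [hsz] /andP[zk hzs] hU hV hA.
have hz : all (fun x => z < x) zs
  by apply: order_path_min zs_sorted => // ? ? ?; apply: ltn_trans.
have hzs' := path_sorted zs_sorted.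
have hzV m : all (fun x => z < x) (mask m zs ++ V2).
  by rewrite all_cat all_mask_gt //=; apply: sub_all hV => x; apply: ltn_trans.
have hzU m : all (fun x => z < x) (mask m zs ++ U2).
  by rewrite all_cat all_mask_gt //=; apply: sub_all hU => x; apply: ltn_trans.
case: b => /=.
  have {}IH := IH h.+1 zs (rcons A1 z) A2 hzs' hsz hzs hU hV.
  have -> : (if omap (cons true) (flip h.+1 s) then count negb s - h
             else (count id s).+1)
    = (if flip h.+1 s then count negb s - h.+1 else count id s).+1.
    case e: (flip h.+1 s) => [c|] //=.
    by have := @flip_count h.+1 s; rewrite e => /(_ isT); lia.
  apply: inserts_right1 => //.
    by move=> hn; apply: all_nth_ge => //; rewrite hA leq_addr.
  rewrite !cat_rcons size_rcons in IH.
  by case e: (flip h.+1 s) IH => [c|] /= IH; rewrite cat_rcons; apply: IH; lia.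
(* For surplus 0 the entry [z] is directly below [k] and smaller than everything still unread, so
   [k] drops and then slides past all later falses. For positive surplus [z] lies in an earlier
   column and nothing moves. *)
case: h hA => [|h] hA.
  rewrite addn0 in hA; rewrite subn0 /= add1n; apply: inserts_down => //.
    exact: all_le_head.
  have -> : count negb s = size (mask (map negb s) zs).
    by rewrite size_mask ?size_map // count_map.
  apply: inserts_slide.
  - by apply/allP => x /mem_mask; move: x; apply/allP.
  - exact: all_le_head.
have -> : (if omap (cons false) (flip h s) then (1 + count negb s) - h.+1
           else count id s) = (if flip h s then count negb s - h else count id s).
  by case: (flip h s).
have {}IH := IH h zs A1 (rcons A2 z) hzs' hsz hzs hU hV.
rewrite !cat_rcons size_rcons in IH.
case e: (flip h s) IH => [c|] /= IH; apply: IH; lia.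
Qed.

(** * Following the algorithm cell by cell on words *)

(* A1 and A2 are the untouched left parts of the rows, ks the inserted entries,
   zs their increasing rearrangement and w the word of the right parts. *)
Definition tracks l1 l2 (T : filling [:: l1; l2]) A1 A2 w (ks : seq nat)
    : Prop :=
  exists zs, [/\ sorted ltn zs, perm_eq zs ks, size w = size zs
    & shows T (A1 ++ mask w zs) (A2 ++ mask (map negb w) zs)].

Lemma perm_mask_negb (m : bitseq) (s : seq nat) : size m = size s ->
  perm_eq (mask m s ++ mask (map negb m) s) s.
Proof.
elim: m s => [|b m IH] [|x s] //= [/IH /permP h]; apply/permP => a /=.
by rewrite -h; case: b; rewrite /= !count_cat /=; lia.
Qed.

Lemma sorted_split (k : nat) zs : sorted ltn zs -> k \notin zs ->
  exists z1 z2, [/\ zs = z1 ++ z2, all (fun z => z < k) z1,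
    all (fun z => k < z) z2 & sorted ltn (z1 ++ k :: z2)].
Proof.
move=> hs hk; exists (filter (fun z => z < k) zs), (filter (fun z => k < z) zs).
have h1 := filter_all (fun z => z < k) zs.
have h2 := filter_all (fun z => k < z) zs.
have hsort : sorted ltn (filter (fun z => z < k) zs ++ k :: filter (fun z => k < z) zs).
  rewrite (sorted_pairwise ltn_trans) pairwise_cat
    /= -!(sorted_pairwise ltn_trans).
  rewrite !sorted_filter ?h2 ?andbT //; try exact: ltn_trans.
  apply/allrelP => x y /(allP h1) xk; rewrite inE => /orP[/eqP-> //|].
  by move/(allP h2); apply: ltn_trans.
split=> //; apply: (irr_sorted_eq ltn_trans ltnn hs).
  move: hsort; rewrite !(sorted_pairwise ltn_trans) !pairwise_cat /=.
  rewrite allrel_consr.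
  by case/and3P=> /andP[_ ->] -> /andP[_ ->].
move=> x; rewrite mem_cat !mem_filter -andb_orl -neq_ltn.
by case: eqP => // ->; rewrite (negPf hk).
Qed.

(** A row 1 insertion occurs either with both rows untouched up to the same column, or among
    single-cell columns, where the word contains only trues. *)
Lemma tracks_insert (f : bool) l1 l2 (T : filling [:: l1; l2]) A1 A2 w ks k
    (x : 'I_(sumn [:: l1; l2]).+1) :
  x = k :> nat ->
  (f -> size A2 <= size A1 /\ (size A1 = size A2 \/ all id w)) ->
  tracks T (if f then rcons A1 k else A1) (if f then A2 else rcons A2 k) w ks ->
  let i := count (fun y => y < k) ks in
  exists2 T', insert_entry x T = (T', cost f (take i w))
    & tracks T' A1 A2 (place f (take i w) (drop i w)) (k :: ks).
Proof.
move=> xk hf [zs [zs_sorted zs_perm wsz hs]] i.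
have hm := perm_mask_negb wsz; case: (hs) => sz1 sz2 hu _.
(* The entry [k] still occupies the untouched part, so a second occurrence would contradict the
   absence of repetitions. *)
have kzs : k \notin zs.
  apply/negP; rewrite -(perm_mem hm) mem_cat => hk.
  have : count_mem k ((if f then rcons A1 k else A1) ++ mask w zs
    ++ (if f then A2 else rcons A2 k) ++ mask (map negb w) zs) <= 1.
    by rewrite catA count_uniq_mem // leq_b1.
  rewrite !count_cat.
  have h1 : 0 < count_mem k (mask w zs) + count_mem k (mask (map negb w) zs).
    by rewrite addn_gt0 -!has_count !has_pred1.
  by case: (f) h1; rewrite -cats1 count_cat /= eqxx; lia.
have [z1 [z2 [ez hz1 hz2 hsort]]] := sorted_split zs_sorted kzs.
have ei : i = size z1.
  rewrite /i -(permP zs_perm) ez count_cat (eq_in_count (a2 := predT) (s := z1)).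
    rewrite count_predT (eq_in_count (a2 := pred0) (s := z2)) ?count_pred0
      ?addn0 //.
    by move=> y /(allP hz2) /=; lia.
  by move=> y /(allP hz1).
have hperm : perm_eq (z1 ++ k :: z2) (k :: ks).
  by rewrite -cat1s perm_catCA /= perm_cons -ez.
pose s := take i w; pose t := drop i w.
have ew : w = s ++ t by rewrite cat_take_drop.
have ssz : size s = size z1.
  by rewrite size_takel ei // wsz ez size_cat leq_addr.
have mE : mask w zs = mask s z1 ++ mask t z2 by rewrite ew ez mask_cat.
have mnE : mask (map negb w) zs = mask (map negb s) z1 ++ mask (map negb t) z2.
  by rewrite ew ez map_cat mask_cat // size_map.
have hfuel : cost f s <= sumn [:: l1; l2].
  rewrite /= addn0; apply: (@leq_trans (size zs)).
    apply: (@leq_trans (size s)); last by rewrite ssz ez size_cat leq_addr.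
    by rewrite /cost; case: ifP => _; apply: count_size.
  by rewrite -(perm_size hm) -sz1 -sz2 !size_cat leq_add // leq_addl.
rewrite -/s -/t {}mE {}mnE {zs_sorted zs_perm hm kzs sz1 sz2 hu} in hs *.
case: f hf hs hfuel => [/(_ isT)[hle hA] | _]; rewrite cat_rcons => hs hfuel.
  pose h := size A1 - size A2.
  have hz2m m : all (fun z => k < z) (mask m z2) := all_mask_gt m hz2.
  have hAh : size A1 = size A2 + h by rewrite subnKC.
  have hz1s : sorted ltn z1 by move: hsort => /cat_sorted2[].
  have := inserts_row1 hz1s ssz hz1 (hz2m t) (hz2m (map negb t)) hAh.
  (* The surplus [h] of [inserts_row1] is 0 if the untouched parts are aligned. Otherwise [s] has no
     false, and its value is irrelevant. *)
  have [-> ->] : flip h s = flip 0 s /\ count negb s - h = count negb s.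
    case: hA => [e|hall]; first by rewrite /h e subnn subn0.
    have hs0 : count negb s = 0.
      move: hall; rewrite ew all_cat => /andP[/allP hall _].
      by apply/eqP; rewrite -leqn0 leqNgt -has_count;
        apply/hasPn => b /hall /= ->.
    have flip0 h' : flip h' s = None.
      by case e: (flip h' s) (@flip_count h' s) => [c|] // /(_ isT);
        rewrite hs0.
    by rewrite !flip0 hs0.
  have -> : (if flip 0 s then count negb s else count id s) = cost true s.
    by rewrite /cost; case: (flip 0 s).
  move=> hins; have [T' e hT'] := hins _ _ _ x _ hs xk hfuel.
  exists T' => //; exists (z1 ++ k :: z2); split=> //.
    by rewrite size_place -size_cat -ew wsz ez !size_cat /= addnS.
  move: hT'; rewrite /place; case ef: (flip 0 s) => [c|].
    by rewrite map_cat !mask_cat ?size_map ?(flip_size ef).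
  by rewrite map_cat !mask_cat ?size_map.
have hins : inserts k (A1 ++ mask s z1 ++ mask t z2)
    (A2 ++ k :: mask (map negb s) z1 ++ mask (map negb t) z2)
    (A1 ++ mask s z1 ++ mask t z2)
    (A2 ++ mask (map negb s) z1 ++ k :: mask (map negb t) z2) (cost false s).
  have -> : cost false s = size (mask (map negb s) z1).
    by rewrite size_mask ?size_map // count_map.
  apply: inserts_slide; last by apply/all_le_head/all_mask_gt.
  by apply/allP => y /mem_mask; move: y; apply/allP.
have [T' e hT'] := hins _ _ _ x _ hs xk hfuel.
exists T' => //; exists (z1 ++ k :: z2); split=> //.
  by rewrite size_place -size_cat -ew wsz ez !size_cat /= addnS.
by rewrite /place map_cat !mask_cat ?size_map.
Qed.

Fixpoint column_cells j d q : seq (nat * nat) :=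
  if q is q'.+1 then (1, j) :: (2, j) :: column_cells j.+1 d q'
  else [seq (1, i) | i <- iota j d].

Lemma size_column_cells j d q : size (column_cells j d q) = q + d + q.
Proof.
elim: q j => [|q IH] j /=; first by rewrite size_map size_iota addn0.
by rewrite IH; lia.
Qed.

(** A right fold over the cells in increasing order matches the recursion of [run]. *)
Definition nps_foldr la (T : filling la) (cs : seq (cell la))
  : filling la * nat :=
  foldr (fun c s => let: (T', m) := insert_entry (T c) s.1 in (T', s.2 + m))
        (T, 0) cs.

Lemma nps_foldr_cons l1 l2 (T : filling [:: l1; l2]) c cs (f : bool) fl
    (A1 A2 : seq nat) :
  let ks := [seq (T e : nat) | e <- cs] in
  size fl = size cs ->
  (f -> size A2 <= size A1 /\ (size A1 = size A2 \/ all id (run fl ks).1)) ->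
  tracks (nps_foldr T cs).1 (if f then rcons A1 (T c) else A1)
    (if f then A2 else rcons A2 (T c)) (run fl ks).1 ks ->
  (nps_foldr T cs).2 = (run fl ks).2 ->
  let ks' := [seq (T e : nat) | e <- c :: cs] in
  tracks (nps_foldr T (c :: cs)).1 A1 A2 (run (f :: fl) ks').1 ks'
  /\ (nps_foldr T (c :: cs)).2 = (run (f :: fl) ks').2.
Proof.
move=> ks hsz hf htr hcost /=; rewrite -/ks.
have [T' e hT'] := tracks_insert (erefl (T c : nat)) hf htr.
by case er: (run fl ks) e hT' hcost => [w m] /= -> hT' ->.
Qed.

Lemma run_nseq_true d ks : all id (run (nseq d true) ks).1.
Proof.
elim: d ks => [|d IH] [|k ks] //=; case e: (run _ _) (IH ks) => [w c] /= hw.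
move: hw; rewrite -{1}(cat_take_drop (count (fun x => x < k) ks) w) all_cat.
case/andP=> h1 h2; rewrite /place.
have -> : flip 0 (take (count (fun x => x < k) ks) w) = None.
  case ef: (flip 0 _) (@flip_count 0 (take (count (fun x => x < k) ks) w)) => [c'|] //.
  move=> /(_ isT); rewrite -has_count => /hasP[b]; move/allP: h1 => h1.
  by move/h1; case: b.
by rewrite all_cat h1.
Qed.

Lemma tracks_nil l1 l2 (T : filling [:: l1; l2]) R1 R2 :
  shows T R1 R2 -> tracks T R1 R2 [::] [::].
Proof. by move=> h; exists [::]; split=> //=; rewrite !cats0. Qed.

Lemma shows_entry1 l1 l2 (T : filling [:: l1; l2]) R1 R2 c j :
  shows T R1 R2 -> ssval c = (1, j.+1) ->
    take j.+1 R1 = rcons (take j R1) (T c).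
Proof.
case=> h1 h2 _ hT ec; rewrite hT ec /entry /= (take_nth 0) // h1.
by have := ssvalP c; rewrite ec mem_diagram2 /= orbF.
Qed.

Lemma shows_entry2 l1 l2 (T : filling [:: l1; l2]) R1 R2 c j :
  shows T R1 R2 -> ssval c = (2, j.+1) ->
    take j.+1 R2 = rcons (take j R2) (T c).
Proof.
case=> h1 h2 _ hT ec; rewrite hT ec /entry /= (take_nth 0) // h2.
by have := ssvalP c; rewrite ec mem_diagram2 /=.
Qed.

Lemma nps_foldr_tail j d l1 l2 (T : filling [:: l1; l2]) R1 R2 cs :
  shows T R1 R2 -> l1 = j + d -> l2 <= j ->
  [seq ssval c | c <- cs] = [seq (1, i) | i <- iota j.+1 d] ->
  let ks := [seq (T e : nat) | e <- cs] in
  tracks (nps_foldr T cs).1 (take j R1) R2 (run (nseq d true) ks).1 ks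
  /\ (nps_foldr T cs).2 = (run (nseq d true) ks).2.
Proof.
move=> hs; case: (hs) => h1 h2 _ _.
elim: d j cs => [|d IH] j [|c cs] //= e1 hj.
  by move=> _; rewrite take_oversize ?h1 ?e1 ?addn0 //; split=> //;
    apply: tracks_nil.
case=> ec ecs; have [||htr hcost] := IH j.+1 cs _ _ ecs; try lia.
apply: (@nps_foldr_cons _ _ T c cs true) => //=.
- by rewrite size_nseq -(size_map (@ssval _ _)) ecs size_map size_iota.
- move=> _; rewrite h2 size_takel ?h1; last by lia.
  by split=> //; right; apply: run_nseq_true.
- by rewrite -(shows_entry1 hs ec).
Qed.

Lemma nps_foldr_columns j d q l1 l2 (T : filling [:: l1; l2]) R1 R2 cs :
  shows T R1 R2 -> l1 = j + q + d -> l2 = j + q ->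
  [seq ssval c | c <- cs] = column_cells j.+1 d q ->
  let ks := [seq (T e : nat) | e <- cs] in
  tracks (nps_foldr T cs).1 (take j R1) (take j R2) (run (shape_flags d q) ks).1 ks
  /\ (nps_foldr T cs).2 = (run (shape_flags d q) ks).2.
Proof.
move=> hs; case: (hs) => h1 h2 _ _.
elim: q j cs => [|q IH] j cs e1 e2 ecs.
  rewrite (@take_oversize _ j R2); last by rewrite h2 e2 addn0.
  by apply: nps_foldr_tail => //; lia.
case: cs ecs => [|c1 [|c2 cs]] //= [ec1 ec2 ecs].
have [||htr hcost] := IH j.+1 cs _ _ ecs; try lia.
have hcs : size (shape_flags d q) = size cs.
  rewrite size_shape_flags -(size_map (@ssval _ _)) ecs.
  by rewrite size_column_cells.
have [||htr2 hcost2] := @nps_foldr_cons _ _ T c2 cs false (shape_flags d q)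
  (take j.+1 R1) (take j R2) hcs _ _ hcost => //.
  by rewrite /= -(shows_entry2 hs ec2).
apply: (@nps_foldr_cons _ _ T c1 (c2 :: cs) true (false :: shape_flags d q)) => //=.
- by rewrite hcs.
- by move=> _; rewrite !size_takel ?h1 ?h2; try lia; split=> //; left.
- by rewrite -(shows_entry1 hs ec1).
Qed.

Definition cell_lt (x y : nat * nat) : bool :=
  (x.2 < y.2) || (x.2 == y.2) && (x.1 < y.1).

Lemma path_column_cells x j d q : x.2 < j ->
  path cell_lt x (column_cells j d q).
Proof.
elim: q x j => [|q IH] x j hx /=.
  by elim: d x j hx => [|d IHd] x j hx //=; rewrite IHd // andbT /cell_lt /= hx.
by rewrite IH // andbT /cell_lt /= hx ltnn eqxx.
Qed.

Lemma sorted_column_cells d q : sorted cell_lt (column_cells 1 d q).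
Proof. exact: path_sorted (@path_column_cells (0, 0) 1 d q isT). Qed.

Lemma uniq_column_cells d q : uniq (column_cells 1 d q).
Proof.
apply: sorted_uniq (sorted_column_cells d q) => [y x z|x]; rewrite /cell_lt;
  lia.
Qed.

Lemma mem_column_cells s d q i j : ((i, j) \in column_cells s d q) =
  (i == 1) && (s <= j < s + q + d) || (i == 2) && (s <= j < s + q).
Proof.
elim: q s => [|q IH] s /=.
  apply/mapP/idP => [[k]|]; first by rewrite mem_iota => h [-> ->]; lia.
  by move=> h; exists j; rewrite ?mem_iota; [lia | congr (_, _); lia].
rewrite !inE IH !xpair_eqE; lia.
Qed.

(** Both lists are sorted for the same antisymmetric order, have no repetitions and contain the same
    cells. *)
Lemma increasing_cells d q : let la := [:: q + d; q] in
  [seq ssval c | c <- rev (decreasing_cells la)] = column_cells 1 d q.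
Proof.
move=> la; pose le (x y : nat * nat) :=
  (x.2 < y.2) || (x.2 == y.2) && (x.1 <= y.1).
apply: (@sorted_eq _ le).
- by move=> y x z; rewrite /le; lia.
- by move=> [a b] [a' b']; rewrite /le /= => h; congr (_, _); lia.
- rewrite sorted_map rev_sorted; apply: sort_sorted => c c'.
  by rewrite /= /le; lia.
- by apply: sub_sorted (sorted_column_cells d q) => x y; rewrite /cell_lt /le;
  lia.
apply: uniq_perm; last 1 first.
- move=> [i j]; rewrite mem_column_cells; apply/mapP/idP => [[c _ e]|h].
    by have := ssvalP c; rewrite -e mem_diagram2; lia.
  have [c ec] : exists c : cell la, ssval c = (i, j).
    by apply: cell_exists; rewrite mem_diagram2; lia.
  by exists c; rewrite ?ec // mem_rev mem_sort mem_enum.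
- rewrite map_inj_uniq; last exact: val_inj.
  by rewrite rev_uniq sort_uniq enum_uniq.
- exact: uniq_column_cells.
Qed.

Lemma nps_exchanges_run d q (T : filling [:: q + d; q]) : is_tableau T ->
  nps_exchanges T = (run (shape_flags d q)
    [seq (T c : nat) | c <- rev (decreasing_cells [:: q + d; q])]).2.
Proof.
move=> hT; rewrite /nps_exchanges /nps -[decreasing_cells _]revK foldl_rev revK.
set cs := rev _; rewrite -/(nps_foldr T cs).
(* This evaluates [T] at plain index pairs, so that the two rows can be listed; 0 is returned
   outside the diagram. *)
pose cell_at x := nth 0 [seq (T c : nat) | c <- cs]
  (index x (column_cells 1 d q)).
pose R1 := [seq cell_at (1, j) | j <- iota 1 (q + d)].
pose R2 := [seq cell_at (2, j) | j <- iota 1 q].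
have ecs : [seq ssval c | c <- cs] = column_cells 1 d q
  by apply: increasing_cells.
have cell_atE c : cell_at (ssval c) = T c.
  have hc : c \in cs by rewrite mem_rev mem_sort mem_enum.
  rewrite /cell_at -ecs index_map; last exact: val_inj.
  by rewrite (nth_map c) ?index_mem // nth_index.
have hs : shows T R1 R2.
  split; rewrite ?size_map ?size_iota //.
    have -> : R1 ++ R2 = [seq cell_at x | x <- diagram [:: q + d; q]].
      by rewrite /diagram /= cats0 map_cat -!map_comp.
    have /andP[/injectiveP injT _] := hT.
    rewrite map_inj_in_uniq.
      have -> : diagram [:: q + d; q]
          = [seq (1, j) | j <- iota 1 (q + d)] ++ [seq (2, j) | j <- iota 1 q].
        by rewrite /diagram /= cats0.
      rewrite cat_uniq !map_inj_uniq ?iota_uniq ?andbT; try by move=> a b [].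
      by apply/hasPn => x /mapP[j _ ->]; apply/mapP => [[]].
    move=> x y /cell_exists[c <-] /cell_exists[c' <-]; rewrite !cell_atE => h.
    by congr ssval; apply/injT/val_inj.
  move=> c; rewrite -cell_atE; have := ssvalP c.
  case e : (ssval c) => [i j]; rewrite mem_diagram2 /entry /=.
  case/orP=> /andP[/eqP-> /andP[j0 hj]] /=;
    by rewrite (nth_map 0) ?size_iota ?nth_iota ?add1n ?prednK.
(* With [j = 0] the untouched parts are empty: all columns are processed. *)
by have [||_ ->] := @nps_foldr_columns 0 d q _ _ T R1 R2 cs hs _ _ ecs.
Qed.

End TwoRowSimulation.

(** * From tableaux to permutations, and the final formula *)

Lemma perm_tableau_words la (cs : seq (cell la)) :
  uniq cs -> (forall c, c \in cs) -> size cs = sumn la ->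
  perm_eq [seq [seq (T c : nat) | c <- cs] | T : filling la in @is_tableau la]
          (permutations (iota 1 (sumn la))).
Proof.
move=> cs_uniq cs_all cs_size.
have word_inj : injective (fun T : filling la => [seq (T c : nat) | c <- cs]).
  by move=> T T' /eq_in_map e; apply/ffunP => c; apply/val_inj/e.
apply: uniq_perm; rewrite ?permutations_uniq ?map_inj_uniq ?enum_uniq //.
move=> ks; rewrite mem_permutations; apply/mapP/idP => [[T hT ->]|hks].
  move: hT; rewrite mem_enum => /andP[/injectiveP injT /eqP hT].
  apply: uniq_perm; rewrite ?iota_uniq ?map_inj_uniq //.
    by move=> c d /val_inj/injT.
  move=> x; rewrite mem_iota add1n ltnS;
    apply/mapP/idP => [[c _ ->]|/andP[x0 xn]].
    have : T c \in T @: [set: cell la] by rewrite imset_f.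
    by rewrite hT inE => -> /=; rewrite -ltnS ltn_ord.
  have : inord x \in T @: [set: cell la] by rewrite hT inE inordK.
  by case/imsetP=> c _ e; exists c => //; rewrite -e inordK.
(* The preimage of a permutation puts its successive values into the cells in the order of [cs];
   they are at most [sumn la], so [inord] does not alter them. *)
pose T : filling la := [ffun c => inord (nth 0%N ks (index c cs))].
have ks_size : size ks = size cs by rewrite (perm_size hks) size_iota cs_size.
have TE c : T c = nth 0%N ks (index c cs) :> nat.
  rewrite ffunE inordK //.
  have : nth 0%N ks (index c cs) \in ks by rewrite mem_nth // ks_size index_mem.
  by rewrite (perm_mem hks) mem_iota add1n => /andP[].
have eks : [seq (T c : nat) | c <- cs] = ks.
  apply: (@eq_from_nth _ 0%N); rewrite size_map // => i hi.
  have /hasP[c0 _ _] : has predT cs by rewrite has_predT (leq_ltn_trans _ hi).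
  by rewrite (nth_map c0) // TE index_uniq.
exists T => //; rewrite mem_enum; apply/andP; split.
  apply/injectiveP => c d /(congr1 val) /= /eqP.
  rewrite !TE nth_uniq ?ks_size ?index_mem ?(perm_uniq hks) ?iota_uniq //.
  by move/eqP/(congr1 (nth c cs)); rewrite !nth_index.
apply/eqP/setP => x; rewrite inE.
have -> : (0 < x)%N = ((x : nat) \in [seq (T c : nat) | c <- cs]).
  by rewrite eks (perm_mem hks) mem_iota add1n ltn_ord andbT.
apply/imsetP/mapP => [[c _ ->]|[c _ e]]; first by exists c.
by exists c => //; apply: val_inj.
Qed.

Lemma nps_complexity_two_rows d q :
  nps_complexity [:: (q + d)%N; q] = avg_cost (q + d) q.
Proof.
set la := [:: _; _]; pose cs := rev (decreasing_cells la).
have cs_map : [seq ssval c | c <- cs] = column_cells 1 d q := increasing_cells d q.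
have cs_size : size cs = sumn la.
  by rewrite -(size_map (@ssval _ _)) cs_map size_column_cells /= addn0.
have cs_uniq : uniq cs by rewrite rev_uniq sort_uniq enum_uniq.
have cs_all c : c \in cs by rewrite mem_rev mem_sort mem_enum.
pose F ks : rat := (run (shape_flags d q) ks).2%:R.
rewrite /nps_complexity.
have -> : \sum_(T : filling la | is_tableau T) (nps_exchanges T)%:R
    = \sum_(ks <- permutations (iota 1 (sumn la))) F ks.
  rewrite -(perm_big _ (perm_tableau_words cs_uniq cs_all cs_size)) big_map /=.
  rewrite -big_enum; apply: eq_big_seq => T; rewrite mem_enum => hT.
  by rewrite nps_exchanges_run.
rewrite (sum_permutations_run (fun _ c => c%:R)) ?iota_uniq //; last first.
  by rewrite size_shape_flags size_iota /= addn0.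
rewrite run_sum_shape_cost /= addn0 mulrC mulKf //.
by rewrite pnatr_eq0 -lt0n fact_gt0.
Qed.

Theorem mainTheorem7 (l1 l2 : nat) (hl2 : (1 <= l2)%N) (hl12 : (l2 <= l1)%N) :
  nps_complexity [:: l1; l2] =
    l1%:R * (l1%:R - 1) / 4%:R + l2%:R * (l2%:R - 3%:R) / 4%:R
    - 2%:R *
      (- (2%:R ^+ l2 / 'C(l1 + l2, l2)%:R
          * (\sum_(1 <= i < l2.+1) 'C(i + l1, i)%:R / 2%:R ^+ i + 1))
       + (- 1 - l1%:R + l2%:R) / 2%:R
         * (\sum_(1 <= i < l2.+1)
              2%:R ^+ i / (i%:R * 'C(i + l1, i)%:R)
              * (\sum_(1 <= j < i.+1) 'C(j + l1, j)%:R / 2%:R ^+ j))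
       - (1 + l1%:R - l2%:R) / 2%:R
         * (\sum_(1 <= i < l2.+1) 2%:R ^+ i / (i%:R * 'C(i + l1, i)%:R))
       + (1 + l1%:R - l2%:R)
         * (harmonic l1 + 2%:R^-1 * harmonic l2 - harmonic (l1 - l2)%N)
       + 1).
Proof.
(* The shape is viewed as [l2] full columns followed by [l1 - l2] single cells. *)
have e : l1 = (l2 + (l1 - l2))%N by rewrite subnKC.
rewrite {1}e nps_complexity_two_rows -e.
exact: avg_costE.
Qed.
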